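(* Let $X_t=\mu t+\sigma W_t$ with $\mu\in\mathbb{R}$, $\sigma>0$, let $a>0$, and let $\tau_a^n$ be the $n$-th drawdown time without recovery. For all $n\in\mathbb{N}$ and $\lambda,x>0$, $$\mathbb{E}\left[e^{-\lambda\tau_a^n};\,X_{\tau_a^n}>x\right]=\left(\frac{c_\lambda}{b_\lambda}\right)^n e^{-b_\lambda(x+na)}\sum_{m=0}^{n-1}\frac{(b_\lambda(x+na))^m}{m!}.$$
   Context: $X_t=\mu t+\sigma W_t$ ($X_0=0$) with $W$ a standard Brownian motion, $\mu\in\mathbb{R}$, $\sigma>0$; $a>0$ is fixed; $M_{[s,t]}=\sup_{s\le u\le t}X_u$; $\mathbb{N}=\{1,2,\dots\}$; $\inf\emptyset=\infty$. The drawdown times without recovery are defined by $\tau_a^0=0$ and $$\tau_a^n=\inf\{t>\tau_a^{n-1}:\ M_{[\tau_a^{n-1},t]}-X_t\ge a\}.$$ Notation: $\mathbb{E}[Y;U]=\mathbb{E}[Y1_U]$. Constants: $\beta_\lambda^{\pm}=\dfrac{-\mu\pm\sqrt{\mu^2+2\lambda\sigma^2}}{\sigma^2}$, $b_\lambda=\dfrac{\beta_\lambda^+e^{-\beta_\lambda^-a}-\beta_\lambda^-e^{-\beta_\lambda^+a}}{e^{-\beta_\lambda^-a}-e^{-\beta_\lambda^+a}}$, $c_\lambda=\dfrac{\beta_\lambda^+-\beta_\lambda^-}{e^{-\beta_\lambda^-a}-e^{-\beta_\lambda^+a}}$. *)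

(* Defs.v *)
From HB Require Import structures.
From mathcomp Require Import all_boot all_order all_algebra.
From mathcomp Require Import all_classical all_reals all_analysis.

Set Implicit Arguments.
Unset Strict Implicit.
Unset Printing Implicit Defensive.

Import Order.TTheory GRing.Theory Num.Theory.
Import numFieldNormedType.Exports.

Local Open Scope classical_set_scope.
Local Open Scope ring_scope.

Section Probability.
Context (d : measure_display) (T : measurableType d) (R : realType)
  (P : probability T R).

(* Choosing some of the sets B i equal to setT gives the product rule for
   every subfamily. *)
Definition independent_RVs (I : finType) (X : I -> T -> R) : Prop :=
  forall B : I -> set R, (forall i, measurable (B i)) ->
    P (\bigcap_i (X i @^-1` B i)) = (\prod_i P (X i @^-1` B i))%E.

(* Processes are indexed by all of R, but only times t >= 0 are constrained.
   The second parameter of normal_prob is the standard deviation, so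
   W t - W s has variance t - s. *)
Record standard_brownian_motion (W : R -> {RV P >-> R}) : Prop := {
  sbm_start : {ae P, forall w, W 0 w = 0};
  sbm_independent_increments : forall (n : nat) (t : nat -> R),
    0 <= t 0%N -> {homo t : i j / (i <= j)%N >-> i <= j} ->
    independent_RVs (fun i : 'I_n => W (t i.+1) \- W (t i));
  sbm_gaussian_increments : forall s t : R, 0 <= s -> s < t ->
    forall A : set R, measurable A ->
    pushforward P (W t \- W s) A = normal_prob 0 (Num.sqrt (t - s)) A;
  sbm_continuous_paths :
    {ae P, forall w, {within `[0, +oo[, continuous (fun t : R => W t w)}} }.

(* E[Y; U] = E[Y 1_U] *)
Definition expectation_on (Y : T -> R) (U : set T) : \bar R :=
  'E_P[fun w => Y w * \1_U w].

Definition drifted_brownian_motion (mu sigma : R) (W : R -> {RV P >-> R})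
    (t : R) (w : T) : R :=
  mu * t + sigma * W t w.

End Probability.

Section Drawdown.
Context (R : realType).
Implicit Types (a t : R) (s : \bar R) (x : R -> R).

(* supremum of the path x over [s, t]; s may be +oo, the interval is then
   empty *)
Definition running_sup x s t : \bar R :=
  ereal_sup [set (x u)%:E | u in [set u : R | (s <= u%:E)%E /\ u <= t]].

(* If the previous time is +oo the set is empty, and ereal_inf set0 = +oo. *)
Fixpoint drawdown_time a x (n : nat) : \bar R :=
  if n is m.+1 then
    ereal_inf [set t%:E | t in [set t : R |
      (drawdown_time a x m < t%:E)%E /\
      (a%:E <= running_sup x (drawdown_time a x m) t - (x t)%:E)%E]]
  else 0%E.

(* exp (- lambda tau), equal to 0 when tau = +oo *)
Definition discount (lambda : R) (tau : \bar R) : R :=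
  fine (expeR (- (lambda%:E * tau))%E).

End Drawdown.

Section Constants.
Context (R : realType).
Implicit Types mu sigma lambda a : R.

Definition beta_plus mu sigma lambda : R :=
  (- mu + Num.sqrt (mu ^+ 2 + 2 * lambda * sigma ^+ 2)) / sigma ^+ 2.

Definition beta_minus mu sigma lambda : R :=
  (- mu - Num.sqrt (mu ^+ 2 + 2 * lambda * sigma ^+ 2)) / sigma ^+ 2.

Definition b_const mu sigma a lambda : R :=
  let bp := beta_plus mu sigma lambda in
  let bm := beta_minus mu sigma lambda in
  (bp * expR (- bm * a) - bm * expR (- bp * a)) /
  (expR (- bm * a) - expR (- bp * a)).

Definition c_const mu sigma a lambda : R :=
  let bp := beta_plus mu sigma lambda in
  let bm := beta_minus mu sigma lambda in
  (bp - bm) / (expR (- bm * a) - expR (- bp * a)).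

End Constants.

(* Main.v *)
(* The argument discretises X on the dyadic grids of mesh h = 2^-m and horizon
   2^m, and follows the Markov chain of drawdown counts on the grid.

   Between drawdowns the expected discounted reward is a combination of
   exp (- beta^+ y) and exp (- beta^- y), y the current drawdown, and exp (beta X)
   discounted at rate lambda is an exact martingale along the grid.  The only
   errors are committed when the drawdown is reflected at 0 (second order in the
   jump, by the equation V_k' = b V_k - c V_(k+1)(. - a)) and when the level a is
   overshot (first order).  Adding eta times a barrier whose drift is negative
   there yields a supermartingale as soon as h is small enough for eta; the same
   for -V gives the limit of the mean discounted reward, and only the moment
   generating function of the Gaussian increments is used.

   Pathwise, the grid chain counts drops of size a greedily, so its discount
   factor increases with m to a limit which is at most exp (- lambda tau_a^n),
   and at least exp (- lambda tau_a'^n) for a' > a.  Its mean is (c/b)^n, which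
   is continuous in a, so that the limit is exp (- lambda tau_a^n) almost surely.

   The reward 1_(X > x) is approximated by ramps, for which V_k is a difference
   quotient of stop-loss transforms of Erlang distributions. *)

Require Import Defs.
From HB Require Import structures.
From mathcomp Require Import all_boot all_order all_algebra.
From mathcomp Require Import all_classical all_reals all_analysis.
From mathcomp Require Import ring lra measurable_realfun.

Set Implicit Arguments.
Unset Strict Implicit.
Unset Printing Implicit Defensive.

Import Order.TTheory GRing.Theory Num.Theory.
Import numFieldNormedType.Exports.

Local Open Scope classical_set_scope.
Local Open Scope ring_scope.

(** A grid of mesh h makes 1 / h steps per unit of time, so the error of one step must have mean
    o(h). A jump is of order sqrt h: a single reflection may already cost order h, and a direct
    estimate would have to control how often the chain reflects. The barrier does this without
    counting: reflecting by r lowers it by r, which beats an error of order r^2 once r is small.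
    Overshoots are paid by a fixed drop at each of the n drawdowns, large jumps by a Chernoff bound
    of order h^2.

    The function with value v0 at drawdown 0 and v1 at drawdown a has slope - (b v0 - c v1) at 0;
    this is the origin of b and c. Under the discounted law the maximum rises by an exponential
    amount of rate b before each drawdown. With i drawdowns left, the value of 1_(X > x) at level m
    is therefore (c/b)^i times the tail at b (x - m + i a) of a sum of i standard exponentials. It
    jumps for i = 0 and has a kink for i = 1, whereas [level_values] asks for Lipschitz values and
    quadratic remainders; averaging the threshold over [x, x + e] restores both. *)

Section ExpBounds.
Context (R : realType).
Implicit Types x r : R.

Lemma expR_taylor1_ge0 x : 0 <= expR x - 1 - x.
Proof. by have := expR_ge1Dx x; lra. Qed.

(** The bound [1 + x <= expR x] at [- x] reads [expR x * (1 - x) <= 1]; the two together give the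
    Taylor remainder without derivatives. *)
Lemma expR_taylor1_le x : expR x - 1 - x <= x ^+ 2 * expR `|x|.
Proof.
have h1 := expR_ge1Dx x.
have h2 : expR x * (1 - x) <= 1.
  have := expR_ge1Dx (- x).
  rewrite expRN -(ler_pM2l (expR_gt0 x)) mulfV ?gt_eqF ?expR_gt0//.
have e0 := expR_gt0 x.
have [x0|x0] := leP 0 x.
  by rewrite ger0_norm//; nra.
have e1 : 1 <= expR `|x| by rewrite -expR0 ler_expR.
have : x ^+ 2 * 1 <= x ^+ 2 * expR `|x| by rewrite ler_wpM2l ?sqr_ge0.
by nra.
Qed.

Lemma expR_taylor0_le x : `|expR x - 1| <= `|x| * expR `|x|.
Proof.
have h1 := expR_ge1Dx x.
have h2 : expR x * (1 - x) <= 1.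
  have := expR_ge1Dx (- x).
  rewrite expRN -(ler_pM2l (expR_gt0 x)) mulfV ?gt_eqF ?expR_gt0//.
have e0 := expR_gt0 x.
have [x0|x0] := leP 0 x.
  have h3 : 0 <= expR x - 1 by lra.
  by rewrite (ger0_norm h3) (ger0_norm x0); nra.
have e1 : 1 <= expR (- x) by rewrite -expR0 ler_expR; lra.
rewrite (ltr0_norm x0) ler0_norm; last by rewrite subr_le0 -expR0 ler_expR ltW.
by nra.
Qed.

(** With [q = sqrt h] it bounds [exp (- delta / q)] by a multiple of [q ^+ 4 = h ^+ 2], which is
    o(h). *)
Lemma expR_ge_pow4 x : 0 <= x -> (x / 4) ^+ 4 <= expR x.
Proof.
move=> x0; have -> : expR x = expR (x / 4) ^+ 4.
  by rewrite -expRM_natl; congr expR; field.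
apply: lerXn2r; rewrite ?nnegrE ?expR_ge0 ?divr_ge0//.
by have := expR_ge1Dx (x / 4); lra.
Qed.

End ExpBounds.

(** * The value function and its barrier *)

Section TwoExponentials.
Context (R : realType) (mu sigma a lambda : R).
Hypotheses (sigma_gt0 : 0 < sigma) (a_gt0 : 0 < a) (lambda_gt0 : 0 < lambda).
Implicit Types C v r x y z : R.

Local Notation bp := (beta_plus mu sigma lambda).
Local Notation bm := (beta_minus mu sigma lambda).
Local Notation b := (b_const mu sigma a lambda).
Local Notation c := (c_const mu sigma a lambda).

Let disc_gt : mu ^+ 2 < mu ^+ 2 + 2 * lambda * sigma ^+ 2.
Proof. by rewrite ltrDl !mulr_gt0// exprn_gt0. Qed.

Let abs_mu_lt : `|mu| < Num.sqrt (mu ^+ 2 + 2 * lambda * sigma ^+ 2).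
Proof.
by rewrite -sqrtr_sqr ltr_sqrt// (le_lt_trans _ disc_gt)// sqr_ge0.
Qed.

Lemma beta_plus_gt0 : 0 < bp.
Proof.
rewrite /beta_plus divr_gt0 ?exprn_gt0//.
by have := ler_norm mu; have := abs_mu_lt; lra.
Qed.

Lemma beta_minus_lt0 : bm < 0.
Proof.
rewrite /beta_minus pmulr_llt0 ?invr_gt0 ?exprn_gt0//.
have := ler_norm (- mu); rewrite normrN; have := abs_mu_lt; lra.
Qed.

(** The left-hand side is the growth rate of the mean of [exp (bp * X)], which discounting at rate
    [lambda] cancels exactly. *)
Lemma beta_plusE : bp * mu + bp ^+ 2 * sigma ^+ 2 / 2 = lambda.
Proof.
rewrite /beta_plus; set q := Num.sqrt _.
have qq : q ^+ 2 = mu ^+ 2 + 2 * lambda * sigma ^+ 2.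
  by rewrite sqr_sqrtr// (le_trans (sqr_ge0 mu)) ?ltW.
have s0 : sigma != 0 by rewrite gt_eqF.
have -> : lambda = (q ^+ 2 - mu ^+ 2) / (2 * sigma ^+ 2).
  by rewrite qq; field.
by field.
Qed.

Lemma beta_minusE : bm * mu + bm ^+ 2 * sigma ^+ 2 / 2 = lambda.
Proof.
rewrite /beta_minus; set q := Num.sqrt _.
have qq : q ^+ 2 = mu ^+ 2 + 2 * lambda * sigma ^+ 2.
  by rewrite sqr_sqrtr// (le_trans (sqr_ge0 mu)) ?ltW.
have s0 : sigma != 0 by rewrite gt_eqF.
have -> : lambda = (q ^+ 2 - mu ^+ 2) / (2 * sigma ^+ 2).
  by rewrite qq; field.
by field.
Qed.

Local Notation gap := (expR (- bm * a) - expR (- bp * a)).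

Lemma exp_gap_gt0 : 0 < gap.
Proof.
rewrite subr_gt0 ltr_expR ltr_pM2r// ltrN2.
exact: lt_trans beta_minus_lt0 beta_plus_gt0.
Qed.

Lemma b_const_gt0 : 0 < b.
Proof.
have bp0 := beta_plus_gt0; have bm0 := beta_minus_lt0.
rewrite /b_const divr_gt0// ?exp_gap_gt0//.
have := expR_gt0 (- bm * a); have := expR_gt0 (- bp * a); nra.
Qed.

Lemma c_const_gt0 : 0 < c.
Proof.
have bp0 := beta_plus_gt0; have bm0 := beta_minus_lt0.
by rewrite /c_const divr_gt0 ?exp_gap_gt0//; lra.
Qed.

(* [interp v0 v1] is the combination of [exp (- bp y)] and [exp (- bm y)] with
   the values v0 at 0 and v1 at a: as a function of the drawdown it is
   lambda-harmonic for the drifted Brownian motion. *)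
Definition wplus (v0 v1 : R) := (v0 * expR (- bm * a) - v1) / gap.
Definition wminus (v0 v1 : R) := (v1 - v0 * expR (- bp * a)) / gap.
Definition interp (v0 v1 y : R) :=
  wplus v0 v1 * expR (- bp * y) + wminus v0 v1 * expR (- bm * y).

Let gap_neq0 : gap != 0. Proof. by rewrite gt_eqF ?exp_gap_gt0. Qed.

Lemma wplusDwminus v0 v1 : wplus v0 v1 + wminus v0 v1 = v0.
Proof. by rewrite /wplus /wminus; field. Qed.

Lemma interp0 v0 v1 : interp v0 v1 0 = v0.
Proof. by rewrite /interp !mulr0 expR0 !mulr1 wplusDwminus. Qed.

Lemma interp_a v0 v1 : interp v0 v1 a = v1.
Proof. by rewrite /interp /wplus /wminus; field. Qed.

(** Minus the derivative of [interp v0 v1] at drawdown 0. *)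
Lemma interp_slope v0 v1 :
  wplus v0 v1 * bp + wminus v0 v1 * bm = b * v0 - c * v1.
Proof. by rewrite /wplus /wminus /b_const /c_const /=; field. Qed.

(** Since [expR (- bp * a) < expR (- bm * a)], the same constant bounds both weights. *)
Definition weight_bound (C : R) := C * (expR (- bm * a) + 1) / gap.

Lemma weight_bound_ge0 C : 0 <= C -> 0 <= weight_bound C.
Proof.
move=> C0; rewrite /weight_bound divr_ge0 ?(ltW exp_gap_gt0)//.
by rewrite mulr_ge0// addr_ge0 ?expR_ge0.
Qed.

Lemma wplus_le C v0 v1 : `|v0| <= C -> `|v1| <= C ->
  `|wplus v0 v1| <= weight_bound C.
Proof.
move=> h0 h1; rewrite /wplus /weight_bound normrM normfV (gtr0_norm exp_gap_gt0).
rewrite ler_pM2r ?invr_gt0 ?exp_gap_gt0// (le_trans (ler_normB _ _))//.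
rewrite normrM (gtr0_norm (expR_gt0 _)) mulrDr mulr1 lerD//.
by rewrite ler_wpM2r ?expR_ge0.
Qed.

Lemma wminus_le C v0 v1 : `|v0| <= C -> `|v1| <= C ->
  `|wminus v0 v1| <= weight_bound C.
Proof.
move=> h0 h1; rewrite /wminus /weight_bound normrM normfV (gtr0_norm exp_gap_gt0).
rewrite ler_pM2r ?invr_gt0 ?exp_gap_gt0// (le_trans (ler_normB _ _))//.
rewrite normrM (gtr0_norm (expR_gt0 _)) addrC mulrDr mulr1 lerD//.
rewrite ler_pM ?normr_ge0 ?expR_ge0//.
by have := exp_gap_gt0; lra.
Qed.

Local Notation kap := (bp - bm).

Let abs_beta x : x = bp \/ x = bm -> `|x| <= kap.
Proof.
have := beta_plus_gt0; have := beta_minus_lt0 => ? ?.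
by case=> ->; [rewrite gtr0_norm|rewrite ltr0_norm] => //; lra.
Qed.

Let kap_gt0 : 0 < kap.
Proof. by have := beta_plus_gt0; have := beta_minus_lt0; lra. Qed.

Let exp_quad x r : x = bp \/ x = bm -> 0 <= r <= 1 ->
  `|expR (- x * - r) - 1 - r * x| <= kap ^+ 2 * expR kap * r ^+ 2.
Proof.
move=> /abs_beta hx /andP[r0 r1].
have hr : `|x * r| <= kap.
  rewrite normrM (ger0_norm r0) -[leRHS]mulr1 ler_pM ?normr_ge0//.
rewrite mulrNN [r * x]mulrC ger0_norm ?expR_taylor1_ge0//.
rewrite (le_trans (expR_taylor1_le _))// exprMn mulrAC ler_wpM2r ?sqr_ge0//.
rewrite ler_pM ?sqr_ge0 ?expR_ge0 ?ler_expR//.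
by rewrite -(real_normK (num_real x)) !expr2 ler_pM.
Qed.

Let exp_lin x r : x = bp \/ x = bm -> 0 <= r <= 1 ->
  `|expR (- x * r) - 1| <= kap * expR kap * r.
Proof.
move=> /abs_beta hx /andP[r0 r1].
have hr : `|- x * r| <= kap.
  rewrite normrM normrN (ger0_norm r0) -[leRHS]mulr1 ler_pM ?normr_ge0//.
rewrite (le_trans (expR_taylor0_le _))// [leRHS]mulrAC.
rewrite ler_pM ?normr_ge0 ?expR_ge0 ?ler_expR//.
by rewrite normrM normrN (ger0_norm r0) ler_wpM2r.
Qed.

(** A drawdown of [- r] occurs when a step passes the running maximum by [r]. The first-order term
    is the one that [level_taylor] gives for [V k (M + r)], so moving the maximum up costs only
    order [r ^+ 2]. *)
Lemma interp_taylor C v0 v1 r : `|v0| <= C -> `|v1| <= C -> 0 <= r <= 1 ->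
  `|interp v0 v1 (- r) - v0 - r * (b * v0 - c * v1)| <=
  2 * weight_bound C * (kap ^+ 2 * expR kap) * r ^+ 2.
Proof.
move=> h0 h1 hr; have w1 := wplus_le h0 h1; have w2 := wminus_le h0 h1.
rewrite -interp_slope -{2}(wplusDwminus v0 v1) /interp.
move: w1 w2; move: (wplus v0 v1) (wminus v0 v1) => w w' w1 w2.
rewrite [X in `|X|](_ : _ = w * (expR (- bp * - r) - 1 - r * bp) +
  w' * (expR (- bm * - r) - 1 - r * bm)); last by ring.
rewrite (le_trans (ler_normD _ _))// !normrM.
rewrite [leRHS](_ : _ = weight_bound C * (kap ^+ 2 * expR kap * r ^+ 2) +
  weight_bound C * (kap ^+ 2 * expR kap * r ^+ 2)); last by ring.
apply: lerD; apply: ler_pM; rewrite ?normr_ge0//.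
  by apply: exp_quad => //; left.
by apply: exp_quad => //; right.
Qed.

(** Passing the level [a] by [r] leaves an error of first order which nothing cancels; it is
    affordable because it is committed once per drawdown. *)
Lemma interp_overshoot C v0 v1 r : `|v0| <= C -> `|v1| <= C -> 0 <= r <= 1 ->
  `|interp v0 v1 (a + r) - v1| <=
  2 * weight_bound C * expR (kap * a) * (kap * expR kap) * r.
Proof.
move=> h0 h1 hr; have w1 := wplus_le h0 h1; have w2 := wminus_le h0 h1.
rewrite -{2}(interp_a v0 v1) /interp.
move: w1 w2; move: (wplus v0 v1) (wminus v0 v1) => w w' w1 w2.
rewrite !mulrDr !(expRD (- _ * a)).
rewrite [X in `|X|](_ : _ = w * expR (- bp * a) * (expR (- bp * r) - 1) +
  w' * expR (- bm * a) * (expR (- bm * r) - 1)); last by ring.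
rewrite (le_trans (ler_normD _ _))// !normrM.
rewrite [leRHS](_ : _ =
  weight_bound C * expR (kap * a) * (kap * expR kap * r) +
  weight_bound C * expR (kap * a) * (kap * expR kap * r)); last by ring.
have bnd x : x = bp \/ x = bm -> `|expR (- x * a)| <= expR (kap * a).
  move=> /abs_beta hx; rewrite ger0_norm ?expR_ge0// ler_expR.
  by rewrite ler_pM2r// (le_trans _ hx)// -normrN ler_norm.
have lin := exp_lin _ hr.
by apply: lerD; apply: ler_pM; rewrite ?mulr_ge0 ?normr_ge0//;
  [apply: ler_pM; rewrite ?normr_ge0// bnd//; left|apply: lin; left|
   apply: ler_pM; rewrite ?normr_ge0// bnd//; right|apply: lin; right].
Qed.

(** For jumps beyond the reach of the Taylor bounds; Gaussian tails dominate the exponential rate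
    [kap]. *)
Lemma interp_growth C v0 v1 y z : `|v0| <= C -> `|v1| <= C -> 0 <= y <= a ->
  `|interp v0 v1 (y - z)| <=
  2 * weight_bound C * expR (kap * a) * expR (kap * `|z|).
Proof.
move=> h0 h1 /andP[y0 ya].
have w1 := wplus_le h0 h1; have w2 := wminus_le h0 h1.
rewrite /interp; move: w1 w2; move: (wplus v0 v1) (wminus v0 v1) => w w' w1 w2.
rewrite (le_trans (ler_normD _ _))// !normrM.
rewrite [leRHS](_ : _ = weight_bound C * (expR (kap * a) * expR (kap * `|z|)) +
  weight_bound C * (expR (kap * a) * expR (kap * `|z|))); last by ring.
have bnd x : x = bp \/ x = bm ->
    `|expR (- x * (y - z))| <= expR (kap * a) * expR (kap * `|z|).
  move=> /abs_beta hx; rewrite ger0_norm ?expR_ge0// -expRD ler_expR.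
  rewrite (le_trans (ler_norm _))// normrM normrN -mulrDr.
  rewrite ler_pM ?normr_ge0// (le_trans (ler_normB _ _))//.
  by rewrite lerD2r ger0_norm.
by apply: lerD; apply: ler_pM; rewrite ?normr_ge0// bnd//; [left|right].
Qed.

End TwoExponentials.

(** * Supersolutions under one step of the walk *)

Section Supersolution.
Context (R : realType) (mu sigma a lambda : R).
Hypotheses (sigma_gt0 : 0 < sigma) (a_gt0 : 0 < a) (lambda_gt0 : 0 < lambda).
Implicit Types C r x y z M X xi eta m : R.

Local Notation bp := (beta_plus mu sigma lambda).
Local Notation bm := (beta_minus mu sigma lambda).
Local Notation b := (b_const mu sigma a lambda).
Local Notation c := (c_const mu sigma a lambda).
Local Notation kap := (bp - bm).
Local Notation interp := (interp mu sigma a lambda).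
Local Notation weight_bound := (weight_bound mu sigma a lambda).

(* V k m is the expected discounted reward when k drawdowns have occurred and
   the current drawdown is 0 at level m.  The Taylor condition is a quantitative
   form of the equation V k ' m = b V k m - c V (k+1) (m - a). *)
Record level_values (n : nat) (V : nat -> R -> R) (C : R) : Prop := {
  level_ge0 : 0 <= C;
  level_bound : forall k m, (k <= n)%N -> `|V k m| <= C;
  level_taylor : forall k m r, (k < n)%N -> 0 <= r ->
    `|V k (m + r) - V k m - r * (b * V k m - c * V k.+1 (m - a))|
    <= C * r ^+ 2;
  level_lipschitz : forall k m r, (k <= n)%N -> 0 <= r ->
    `|V k (m - r) - V k m| <= C * r }.

Lemma level_valuesN n V C :
  level_values n V C -> level_values n (fun k m => - V k m) C.
Proof.
case=> C0 h1 h2 h3; split=> //.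
- by move=> k m kn; rewrite normrN h1.
- move=> k m r kn r0; rewrite -normrN; apply: le_trans (h2 k m r kn r0).
  by rewrite le_eqVlt; apply/orP; left; apply/eqP; congr `|_|; ring.
- by move=> k m r kn r0; rewrite -opprD normrN h3.
Qed.

Context (n : nat) (V : nat -> R -> R) (C : R) (HV : level_values n V C).

(** Drawdown [a] below the maximum [M] is position [M - a], where the maximum restarts; after the
    n-th drawdown only the position is rewarded. *)
Definition value (k : nat) M X : R :=
  if (k < n)%N then interp (V k M) (V k.+1 (M - a)) (M - X) else V n X.

(* [E (exp xi) - 1 <= exp_drift * h] for the increment xi of X over a step of size
   [h <= 1]; the barrier constant makes discounting beat this drift. *)
Definition exp_drift : R := `|mu + sigma ^+ 2 / 2| * expR `|mu + sigma ^+ 2 / 2|.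
Definition barrier_const : R := a + (1 + exp_drift) / lambda.
Local Notation K := barrier_const.

(* The barrier decreases at unit rate under reflection of the drawdown at 0, and
   by 1 at each drawdown time. *)
Definition barrier (k : nat) y : R :=
  if (k < n)%N then K - y + (n - k)%:R * (a + 1) else K.

Definition supersol eta (k : nat) M X : R :=
  value k M X + eta * barrier k (M - X).

Definition drawdown_step (k : nat) M X' : nat * (R * R) :=
  if a <= M - X' then (k.+1, (X', X')) else (k, (Num.max M X', X')).

Let a1_ge0 : 0 <= a + 1. Proof. by rewrite addr_ge0 ?ltW. Qed.

Lemma exp_drift_ge0 : 0 <= exp_drift.
Proof. by rewrite mulr_ge0 ?expR_ge0. Qed.

Lemma barrier_const_ge : a <= K.
Proof. rewrite lerDl divr_ge0 ?ltW//; have := exp_drift_ge0; lra. Qed.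

(** The barrier is at least [K - a] while the drawdown is at most [a], so discounting lowers it at
    least at this rate: [exp_drift] of it pays for the drift, and 1 for the large jumps. *)
Lemma barrier_const_gt : lambda * (K - a) = 1 + exp_drift.
Proof. by rewrite /barrier_const addrC addKr mulrC divfK// gt_eqF. Qed.

Lemma barrier_ge k y : y <= a -> K - a <= barrier k y.
Proof.
move=> ya; rewrite /barrier; case: ifP => _; last by rewrite gerBl ltW.
have : 0 <= (n - k)%:R * (a + 1) by rewrite mulr_ge0 ?a1_ge0.
by lra.
Qed.

Lemma barrier_le k y : 0 <= y -> barrier k y <= K + n%:R * (a + 1).
Proof.
move=> y0; rewrite /barrier; case: ifP => _.
  have : (n - k)%:R * (a + 1) <= n%:R * (a + 1).
    by rewrite ler_wpM2r ?a1_ge0// ler_nat leq_subr.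
  by lra.
by rewrite lerDl mulr_ge0 ?a1_ge0.
Qed.

Lemma value_reset k X : (k <= n)%N -> value k X X = V k X.
Proof.
rewrite leq_eqVlt /value => /orP[/eqP ->|kn]; first by rewrite ltnn.
by rewrite kn subrr interp0.
Qed.

Lemma value_le : exists B : R, 0 <= B /\ forall k M X,
  ((k < n)%N -> 0 <= M - X < a) -> `|value k M X| <= B.
Proof.
exists (2 * weight_bound C * expR (kap * a) + C).
have C0 := level_ge0 HV.
have w0 : 0 <= weight_bound C by exact: weight_bound_ge0.
have W0 : 0 <= 2 * weight_bound C * expR (kap * a).
  by rewrite mulr_ge0 ?expR_ge0// mulr_ge0.
split; first by rewrite addr_ge0.
move=> k M X; rewrite /value; case: ifP => kn yr.
  have /andP[y0 ya] := yr isT.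
  have hy : 0 <= M - X <= a by rewrite y0 ltW.
  have := interp_growth mu sigma_gt0 a_gt0 lambda_gt0 0
    (level_bound HV M (ltnW kn)) (level_bound HV (M - a) kn) hy.
  by rewrite subr0 normr0 mulr0 expR0 mulr1; lra.
rewrite (le_trans (level_bound HV X (leqnn n)))// lerDr//.
Qed.

(* The barrier absorbs the second-order error at reflection and the first-order
   error of the overshoot, as soon as the jump xi is small. *)
Lemma supersol_step eta : 0 < eta ->
  exists C1 delta : R, [/\ 0 <= C1, 0 < delta &
  forall k M X xi, (k < n)%N -> 0 <= M - X < a ->
  let: (k', (M', X')) := drawdown_step k M (X + xi) in
  supersol eta k' M' X' <=
    interp (V k M) (V k.+1 (M - a)) (M - X - xi) +
    eta * (barrier k (M - X) + expR xi - 1) +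
    (if `|xi| <= delta then 0 else C1 * expR (kap * `|xi|))].
Proof.
move=> eta0; have C0 := level_ge0 HV.
have w0 : 0 <= weight_bound C by exact: weight_bound_ge0.
have kap0 : 0 < kap.
  by rewrite subr_gt0 (lt_trans (beta_minus_lt0 _ _ _) (beta_plus_gt0 _ _ _)).
have K0 : 0 <= K by rewrite (le_trans _ barrier_const_ge) ?ltW.
set D2 := 2 * weight_bound C * (kap ^+ 2 * expR kap).
have D20 : 0 <= D2.
  by apply: mulr_ge0; apply: mulr_ge0; rewrite ?expR_ge0 ?sqr_ge0.
set D1 := 2 * weight_bound C * expR (kap * a) * (kap * expR kap).

set D0 := 2 * weight_bound C * expR (kap * a).
have D00 : 0 <= D0 by rewrite mulr_ge0 ?expR_ge0// mulr_ge0.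
have D10 : 0 <= D1 by apply: mulr_ge0 => //; rewrite mulr_ge0 ?expR_ge0 ?ltW.
(* Sum of the bounds for the three terms that a large jump may change: the value, the barrier and
   [interp]. *)
set C1 := C + eta * (K + n%:R * (a + 1) + 1) + D0.
have na0 : 0 <= n%:R * (a + 1) by rewrite mulr_ge0 ?a1_ge0.
have C10 : 0 <= C1.
  have : 0 <= eta * (K + n%:R * (a + 1) + 1).
    by apply: mulr_ge0; [exact: ltW|lra].
  by rewrite /C1; lra.
(* The minimum with 1 admits the Taylor bounds; the quotient makes every error coefficient times a
   small jump at most [eta]. *)
pose delta := Num.min 1 (eta / (C + D1 + D2 + eta)).
have delta0 : 0 < delta by rewrite lt_min ltr01 divr_gt0//; lra.
have delta1 : delta <= 1 by rewrite ge_min lexx.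
have deltaE : delta * (C + D1 + D2 + eta) <= eta.
  by rewrite -ler_pdivlMr ?ge_min ?lexx ?orbT//; lra.
exists C1, delta; split => // k M X xi kn yr.
have /andP[y0 ya] := yr.
have v0 : `|V k M| <= C := level_bound HV _ (ltnW kn).
have v1 : `|V k.+1 (M - a)| <= C := level_bound HV _ kn.
have exi := expR_ge1Dx xi.
have exi0 := expR_ge0 xi.
have bE : barrier k (M - X) = K - (M - X) + (n - k)%:R * (a + 1).
  by rewrite /barrier kn.
have bS : barrier k.+1 0 <= K + (n - k)%:R * (a + 1) - (a + 1).
  rewrite /barrier; have -> : (n - k)%:R = 1 + (n - k.+1)%:R :> R.
    by rewrite -(natrD _ 1%N) add1n -subSn.
  by case: ifP => [_|/negbT]; [lra|rewrite -leqNgt => /eqP ->; lra].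
(* Large jumps: each term is estimated by its absolute bound. The second alternative is refuted
   later by the growth bound [hg]. *)
have ie v p q e : 1 <= e -> v <= C -> p <= K + n%:R * (a + 1) -> 0 <= q ->
    v + eta * p <= interp (V k M) (V k.+1 (M - a)) (M - X - xi) + eta * (q + expR xi - 1)
       + C1 * e \/ D0 * e < `|interp (V k M) (V k.+1 (M - a)) (M - X - xi)|.
  move=> e1 hv hp q0; have [hI|hI] := leP `|interp _ _ _| (D0 * e); last by right.
  left; have := lerNnormlW hI; rewrite /C1.
  have : eta * p <= eta * (K + n%:R * (a + 1)) by rewrite ler_pM2l.
  have : eta * 0 <= eta * (q + expR xi) by rewrite ler_pM2l ?addr_ge0.
  have : C * 1 <= C * e by rewrite ler_wpM2l.
  have : eta * (K + n%:R * (a + 1) + 1) * 1 <= eta * (K + n%:R * (a + 1) + 1) * e.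
    by rewrite ler_wpM2l//; apply: mulr_ge0; [exact: ltW|lra].
  by lra.
have hg : `|interp (V k M) (V k.+1 (M - a)) (M - X - xi)| <= D0 * expR (kap * `|xi|).
  by apply: interp_growth => //; rewrite y0 ltW.
have e1 : 1 <= expR (kap * `|xi|).
  by rewrite -expR0 ler_expR mulr_ge0// ltW.
have b0 : 0 <= barrier k (M - X).
  by rewrite (le_trans _ (barrier_ge _ (ltW ya)))// subr_ge0 barrier_const_ge.
have le_xi := ler_norm xi; have le_Nxi := ler_norm (- xi); rewrite normrN in le_Nxi.
rewrite /drawdown_step; case: (leP a) => [reset|noreset].
  rewrite /supersol value_reset// subrr.
  case: ifP => [small|large]; last first.
    have hV := le_trans (ler_norm _) (level_bound HV (X + xi) kn).
    have [//|] := ie _ _ _ _ e1 hV (barrier_le k.+1 (lexx 0)) b0.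
    by rewrite ltNge hg.
  set r := M - X - xi - a.
  have r0 : 0 <= r by rewrite /r; lra.
  have rd : r <= delta by rewrite /r; lra.
  have -> : X + xi = M - a - r by rewrite /r; ring.
  have -> : M - X - xi = a + r by rewrite /r; ring.
  have r01 : 0 <= r <= 1 by rewrite r0 (le_trans rd).
  have h1 := le_trans (ler_norm _) (level_lipschitz HV (M - a) kn r0).
  have := interp_overshoot mu sigma_gt0 a_gt0 lambda_gt0 v0 v1 r01.
  rewrite -/D1 => /lerNnormlW h2.
  (* Of the drop [a + 1] of the barrier, [a] offsets the return of the drawdown from [a] to 0; the
     remaining 1 pays for the errors of order [r]. *)
  have h3 : eta * barrier k.+1 0 <= eta * (barrier k (M - X) + xi - (1 - r)).
    by rewrite ler_pM2l// bE; rewrite /r; lra.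
  (* [expR xi - 1] replaces [xi] so that the final bound is a combination of exponentials of the
     increment. *)
  have h4 : eta * (1 + xi) <= eta * expR xi by rewrite ler_pM2l.
  have h5 : r * (C + D1 + D2 + eta) <= delta * (C + D1 + D2 + eta).
    by rewrite ler_wpM2r//; lra.
  have h6 : 0 <= D2 * r by rewrite mulr_ge0.
  by lra.
have [reflect|noreflect] := ltP M (X + xi).
  rewrite /supersol value_reset ?(ltnW kn)// subrr.
  case: ifP => [small|large]; last first.
    have hV := le_trans (ler_norm _) (level_bound HV (X + xi) (ltnW kn)).
    have [//|] := ie _ _ _ _ e1 hV (barrier_le k (lexx 0)) b0.
    by rewrite ltNge hg.
  set r := X + xi - M.
  have r0 : 0 <= r by rewrite /r; lra.
  have rd : r <= delta by rewrite /r; lra.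
  have -> : X + xi = M + r by rewrite /r; ring.
  have -> : M - X - xi = - r by rewrite /r; ring.
  have r01 : 0 <= r <= 1 by rewrite r0 (le_trans rd).
  have h1 := le_trans (ler_norm _) (level_taylor HV M kn r0).
  have := interp_taylor mu sigma_gt0 a_gt0 lambda_gt0 v0 v1 r01.
  rewrite -/D2 => /lerNnormlW h2.
  (* The term [- eta * r] gained here outweighs the errors [(C + D2) * r ^+ 2], because
     [r <= delta]. *)
  have h3 : barrier k 0 = barrier k (M - X) + xi - r.
    by rewrite bE /barrier kn /r; ring.
  have h4 : eta * (1 + xi) <= eta * expR xi by rewrite ler_pM2l.
  have h5 : r * (r * (C + D1 + D2 + eta)) <= r * eta.
    rewrite ler_wpM2l// (le_trans _ deltaE)// ler_wpM2r//; lra.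
  have h6 : 0 <= (D1 + eta) * r ^+ 2 by rewrite mulr_ge0 ?sqr_ge0 ?addr_ge0// ltW.
  by rewrite h3; lra.
have -> : supersol eta k M (X + xi) =
    interp (V k M) (V k.+1 (M - a)) (M - X - xi) + eta * (barrier k (M - X) + xi).
  rewrite /supersol /value /barrier kn (_ : M - (X + xi) = M - X - xi); last by ring.
  by congr (_ + eta * _); ring.
have h4 : eta * (1 + xi) <= eta * expR xi by rewrite ler_pM2l.
have h5 : 0 <= (if `|xi| <= delta then 0 else C1 * expR (kap * `|xi|)).
  by case: ifP => // _; rewrite mulr_ge0 ?expR_ge0.
by lra.
Qed.

End Supersolution.

(** * One step of the walk *)

Section GaussianMoments.
Context (R : realType).
Implicit Types s m z : R.

Local Notation leb := (@lebesgue_measure R).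

(** The Radon-Nikodym derivative and the normal density have the same integral over every measurable
    set, hence agree almost everywhere. *)
Lemma integral_normal_prob m s (f : R -> \bar R) : s != 0 ->
  measurable_fun setT f -> (forall x, 0 <= f x)%E ->
  (\int[normal_prob m s]_x f x =
   \int[leb]_x (f x * (normal_pdf m s x)%:E))%E.
Proof.
move=> s0 mf f0; have dom := normal_prob_dominates m s.
rewrite -(Radon_Nikodym_SigmaFinite.change_of_variables dom)//.
have mpdf : measurable_fun setT (fun x => (normal_pdf m s x)%:E).
  by apply/measurable_EFinP; exact: measurable_normal_pdf.
have ig := Radon_Nikodym_SigmaFinite.f_integrable dom.
apply: ae_eq_integral => //.
- by apply: emeasurable_funM => //; exact: measurable_int ig.
- exact: emeasurable_funM.
- apply: ae_eqe_mul2l; apply: integral_ae_eq => // A _ mA.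
  by rewrite -Radon_Nikodym_SigmaFinite.f_integral.
Qed.

Lemma normal_mgf sd s : sd != 0 ->
  (\int[normal_prob 0 sd]_z (expR (s * z))%:E =
   (expR (s ^+ 2 * sd ^+ 2 / 2))%:E)%E.
Proof.
move=> sd0; rewrite integral_normal_prob//; last first.
  by apply/measurable_EFinP; apply: measurableT_comp.
under eq_integral => x _.
  (* Completing the square: the tilted density is a multiple of the normal density of mean
     [s * sd ^+ 2]. *)
  have -> : ((expR (s * x))%:E * (normal_pdf 0 sd x)%:E =
     (expR (s ^+ 2 * sd ^+ 2 / 2))%:E * (normal_pdf (s * sd ^+ 2) sd x)%:E)%E.
    rewrite -!EFinM !normal_pdfE// mulrCA [in RHS]mulrCA; congr (_ * _)%:E.
    by rewrite /normal_fun -!expRD; congr expR; field.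
  over.
rewrite integralZl//; last exact: integrable_normal_pdf.
by rewrite integral_normal_pdf mule1.
Qed.

Lemma normal_law_mgf (nu : probability R R) sd s : sd != 0 ->
  (forall A : set R, measurable A -> nu A = normal_prob 0 sd A) ->
  (\int[nu]_z (expR (s * z))%:E = (expR (s ^+ 2 * sd ^+ 2 / 2))%:E)%E.
Proof.
(* The identity reconciles the measurable structures on [R] in which [normal_prob] and [nu] are
   stated. *)
move=> sd0 nuE; pose idR0 : measurableTypeR R -> R := idfun.
have mid : measurable_fun setT idR0 := @measurable_id _ _ setT.
pose idR : {mfun measurableTypeR R >-> R} :=
  HB.pack idR0 (isMeasurableFun.Build _ _ _ _ idR0 mid).
have mexp : measurable_fun [set: R] (fun z => (expR (s * z))%:E).
  by apply/measurable_EFinP; apply: measurableT_comp.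
rewrite -(normal_mgf s sd0).
transitivity (\int[pushforward (normal_prob 0 sd) idR]_z (expR (s * z))%:E)%E.
  by apply: eq_measure_integral => A mA _; exact: nuE.
by rewrite (ge0_integral_pushforward mid)// => z _; rewrite lee_fin expR_ge0.
Qed.

(** Every one-step bound is brought into this form, so that the generating function [G] is all that
    is used of the law of an increment. *)
Lemma integral_expR_combination (nu : probability R R) (G : R -> R)
    (l : seq (R * R)) :
  (forall s, \int[nu]_z (expR (s * z))%:E = (G s)%:E)%E ->
  nu.-integrable setT (fun z => (\sum_(p <- l) p.1 * expR (p.2 * z))%:E) /\
  (\int[nu]_z (\sum_(p <- l) p.1 * expR (p.2 * z))%:E =
   (\sum_(p <- l) p.1 * G p.2)%:E)%E.
Proof.
move=> HG.
have ie s : nu.-integrable setT (fun z => (expR (s * z))%:E).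
  apply/integrableP; split.
    by apply/measurable_EFinP; apply: measurableT_comp.
  under eq_integral do rewrite gee0_abs ?lee_fin ?expR_ge0//.
  by rewrite HG ltry.
elim: l => [|p l [IH1 IH2]].
  rewrite big_nil; under eq_integral do rewrite big_nil.
  rewrite integral0; split => //; apply: (eq_integrable _ (cst 0%E)) => //.
    by move=> z _; rewrite big_nil.
  exact: integrable0.
have ip : nu.-integrable setT (fun z => (p.1%:E * (expR (p.2 * z))%:E)%E).
  exact: integrableZl.
rewrite big_cons; under eq_integral do rewrite big_cons EFinD EFinM.
rewrite integralD// integralZl// HG IH2; split => //.
apply: (eq_integrable _ (fun z => p.1%:E * (expR (p.2 * z))%:E +
  (\sum_(p <- l) p.1 * expR (p.2 * z))%:E)%E) => //.
  by move=> z _; rewrite big_cons EFinD EFinM.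
exact: integrableD.
Qed.

End GaussianMoments.

Section SupersolutionMean.
Context (R : realType) (mu sigma a lambda : R).
Hypotheses (sigma_gt0 : 0 < sigma) (a_gt0 : 0 < a) (lambda_gt0 : 0 < lambda).
Implicit Types h s z M X eta t : R.

Local Notation bp := (beta_plus mu sigma lambda).
Local Notation bm := (beta_minus mu sigma lambda).
Local Notation kap := (bp - bm).

Let kap_gt0 : 0 < kap.
Proof.
by rewrite subr_gt0 (lt_trans (beta_minus_lt0 _ _ _) (beta_plus_gt0 _ _ _)).
Qed.

Definition increment_mgf h t : R :=
  expR (t * (mu * h) + (t * sigma) ^+ 2 * h / 2).

Lemma increment_mgf_plus h : increment_mgf h bp = expR (lambda * h).
Proof.
rewrite /increment_mgf -[in RHS](beta_plusE mu sigma_gt0 lambda_gt0).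
by congr expR; ring.
Qed.

Lemma increment_mgf_minus h : increment_mgf h bm = expR (lambda * h).
Proof.
rewrite /increment_mgf -[in RHS](beta_minusE mu sigma_gt0 lambda_gt0).
by congr expR; ring.
Qed.

Lemma increment_mgf1_le h : 0 < h -> h <= 1 ->
  increment_mgf h 1 <= 1 + exp_drift mu sigma * h.
Proof.
move=> h0 h1; set rho := mu + sigma ^+ 2 / 2.
have -> : increment_mgf h 1 = expR (h * rho).
  by rewrite /increment_mgf /rho; congr expR; field.
have := expR_taylor0_le (h * rho); rewrite normrM (gtr0_norm h0).
have : expR (h * `|rho|) <= expR `|rho| by rewrite ler_expR ler_piMl.
rewrite /exp_drift -/rho => h2 /(le_trans (ler_norm _)) h3.
have : h * `|rho| * expR (h * `|rho|) <= h * `|rho| * expR `|rho|.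
  by rewrite ler_wpM2l// mulr_ge0// ltW.
by lra.
Qed.

(** Chernoff bound: where [|xi| > delta] the factor [exp (s * (|xi| - delta))] is at least 1, and
    the exponential of an absolute value is at most the sum over both signs. *)
Lemma large_jump_le delta xi s : 0 <= s ->
  (if `|xi| <= delta then 0 else expR (kap * `|xi|)) <=
  expR (- (s * delta)) * (expR ((kap + s) * xi) + expR (- (kap + s) * xi)).
Proof.
move=> s0; case: ifP => [_|/negbT]; first by rewrite mulr_ge0 ?addr_ge0 ?expR_ge0.
rewrite -ltNge => large.
apply: (@le_trans _ _ (expR (- (s * delta)) * expR ((kap + s) * `|xi|))).
  rewrite -expRD ler_expR; have : s * delta <= s * `|xi| by rewrite ler_wpM2l// ltW.
  by lra.
rewrite ler_wpM2l ?expR_ge0//.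
have [x0|x0] := leP 0 xi; first by rewrite ger0_norm// lerDl expR_ge0.
by rewrite ltr0_norm// mulrN mulNr lerDr expR_ge0.
Qed.

(** Take [s = 1 / sqrt h]. Then [s ^+ 2 * h = 1] keeps both generating functions below the constant
    [Gc], while [exp (- s * delta)] is of order [h ^+ 2]. *)
Lemma large_jump_mean eta C1 delta : 0 < eta -> 0 <= C1 -> 0 < delta ->
  exists2 h0 : R, 0 < h0 <= 1 & forall h, 0 < h < h0 -> exists2 s : R, 0 <= s &
    C1 * (expR (- (s * delta)) *
      (increment_mgf h (kap + s) + increment_mgf h (- (kap + s)))) <= eta * h.
Proof.
move=> eta0 C10 d0.
set Gc := expR ((kap + 1) * `|mu| + (kap + 1) ^+ 2 * sigma ^+ 2 / 2).
have Gc0 : 0 < Gc by exact: expR_gt0.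
set D := C1 * ((4 / delta) ^+ 4 * (Gc + Gc)).
have D0 : 0 <= D.
  apply: mulr_ge0 => //; apply: mulr_ge0; last by rewrite addr_ge0 ?expR_ge0.
  by apply: exprn_ge0; apply: divr_ge0 => //; exact: ltW.
have den0 : 0 < D + 1 by exact: ltr_wpDl.
exists (Num.min 1 (eta / (D + 1))).
  by rewrite lt_min ltr01 ge_min lexx andbT /= divr_gt0.
move=> h /andP[h0]; rewrite lt_min => /andP[h1 hsmall].
set q := Num.sqrt h.
have q0 : 0 < q by rewrite sqrtr_gt0.
have qq : q ^+ 2 = h by rewrite sqr_sqrtr ?ltW.
have q1 : q <= 1 by rewrite -sqrtr1 ler_sqrt// ltW.
have kq : kap * q <= kap by rewrite ler_piMr// ltW.
have kq0 : 0 <= kap * q by rewrite mulr_ge0// ltW.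
exists q^-1; first by rewrite invr_ge0 ltW.
have mgf_le t : `|t| = kap + q^-1 -> increment_mgf h t <= Gc.
  move=> tE; rewrite ler_expR.
  have e1 : `|t| * h <= kap + 1.
    rewrite tE -qq (_ : _ * _ = kap * q * q + q); last by field; rewrite gt_eqF.
    by rewrite lerD// (le_trans _ kq)// ler_piMr.
  have e2 : t ^+ 2 * h <= (kap + 1) ^+ 2.
    rewrite -(real_normK (num_real t)) tE -qq -exprMn mulrDl mulVf ?gt_eqF//.
    rewrite ler_sqr ?nnegrE ?lerD2r// ler_wpDr//.
    exact: ltW.
  have e3 : t * (mu * h) <= (kap + 1) * `|mu|.
    rewrite mulrCA (le_trans (ler_norm _))// normrM mulrC ler_wpM2r//.
    by rewrite normrM (gtr0_norm h0).
  have e4 : t ^+ 2 * h * sigma ^+ 2 <= (kap + 1) ^+ 2 * sigma ^+ 2.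
    by rewrite ler_wpM2r ?sqr_ge0.
  by rewrite exprMn; lra.
have ks0 : 0 <= kap + q^-1 by rewrite addr_ge0 ?invr_ge0 ?ltW.
have m1 : increment_mgf h (kap + q^-1) <= Gc by apply: mgf_le; rewrite ger0_norm.
have m2 : increment_mgf h (- (kap + q^-1)) <= Gc.
  by apply: mgf_le; rewrite normrN ger0_norm.
have e5 : expR (- (q^-1 * delta)) <= (4 / delta) ^+ 4 * q ^+ 4.
  rewrite expRN -exprMn -[leRHS]invrK -exprVn lef_pV2 ?posrE ?expR_gt0//; last first.
    by apply: exprn_gt0; rewrite invr_gt0 mulr_gt0// divr_gt0.
  rewrite (_ : (4 / delta * q)^-1 = q^-1 * delta / 4); last first.
    by field; rewrite !gt_eqF.
  by rewrite expR_ge_pow4// mulr_ge0// ltW// invr_gt0.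
have e6 : C1 * (expR (- (q^-1 * delta)) *
      (increment_mgf h (kap + q^-1) + increment_mgf h (- (kap + q^-1)))) <=
    C1 * (((4 / delta) ^+ 4 * q ^+ 4) * (Gc + Gc)).
  rewrite ler_wpM2l// ler_pM ?expR_ge0 ?addr_ge0 ?expR_ge0//.
  exact: lerD.
apply: (le_trans e6).
have -> : C1 * ((4 / delta) ^+ 4 * q ^+ 4 * (Gc + Gc)) = h * D * h.
  by rewrite -qq /D; ring.
rewrite ler_wpM2r ?(ltW h0)//.
rewrite ltr_pdivlMr// in hsmall; apply: le_trans (ltW hsmall).
by rewrite ler_wpM2l ?(ltW h0)// lerDl.
Qed.

Context (n : nat) (V : nat -> R -> R) (C : R).
Hypothesis HV : level_values mu sigma a lambda n V C.

Local Notation supersol := (supersol mu sigma a lambda n V).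
Local Notation barrier := (barrier mu sigma a lambda n).

(** Discounting cancels the growth [exp (lambda * h)] of both exponentials in [interp], which is
    thus preserved exactly; on the barrier it gains at least what drift and large jumps cost. The
    shift [C0] makes the integrands nonnegative. *)
Lemma supersol_mean eta : 0 < eta ->
  exists2 h0 : R, 0 < h0 <= 1 & forall h (nu : probability R R) k M X C0 (phi : R -> R),
    0 < h < h0 ->
    (forall t, \int[nu]_z (expR (t * z))%:E = (expR (t ^+ 2 * h / 2))%:E)%E ->
    (k < n)%N -> 0 <= M - X < a ->
    measurable_fun setT phi -> (forall z, 0 <= phi z + C0) ->
    (forall z, let s := drawdown_step a k M (X + (mu * h + sigma * z)) in
      phi z <= expR (- (lambda * h)) * supersol eta s.1 s.2.1 s.2.2) ->
    (\int[nu]_z (phi z + C0)%:E <=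
     (supersol eta k M X + C0)%:E)%E.
Proof.
move=> eta0.
have [C1 [delta [C10 d0 step]]] :=
  supersol_step sigma_gt0 a_gt0 lambda_gt0 HV eta0.
have [h0 /andP[h00 h01] jump] := large_jump_mean eta0 C10 d0.
exists h0; first by rewrite h00.
move=> h nu k M X C0 phi hh HG kn yr mphi phi0 phi_le.
have [s s0 jump_le] := jump h hh.
have /andP[hpos hlt] := hh; have h1 : h <= 1 by lra.
set w1 := wplus mu sigma a lambda (V k M) (V k.+1 (M - a)).
set w2 := wminus mu sigma a lambda (V k M) (V k.+1 (M - a)).
set y := M - X.
pose drift t := expR (t * (mu * h)).
pose e := expR (- (lambda * h)).
pose tail := C1 * expR (- (s * delta)).
(* Pairs of coefficient and exponent in [z]: the two exponentials of [interp], the constants,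
   [expR xi] from the barrier, and the Chernoff bound for both signs. *)
pose l : seq (R * R) :=
  [:: (e * (w1 * expR (- bp * y) * drift bp), bp * sigma);
      (e * (w2 * expR (- bm * y) * drift bm), bm * sigma);
      (e * (eta * (barrier k y - 1)) + C0, 0);
      (e * (eta * drift 1), 1 * sigma);
      (e * (tail * drift (kap + s)), (kap + s) * sigma);
      (e * (tail * drift (- (kap + s))), - (kap + s) * sigma)].
have [il El] := integral_expR_combination (G := fun t => expR (t ^+ 2 * h / 2)) l HG.
have le_l z : phi z + C0 <= \sum_(p <- l) p.1 * expR (p.2 * z).
  rewrite /l !big_cons big_nil /= mul0r expR0 mulr1 addr0.
  set xi := mu * h + sigma * z.
  have dE t : drift t * expR (t * sigma * z) = expR (t * xi).
    by rewrite /drift -expRD; congr expR; rewrite /xi; ring.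
  have := phi_le z; rewrite -/xi; have := step k M X xi kn yr.
  case: (drawdown_step a k M (X + xi)) => k' [M' X'] /= hs hphi.
  have {}hs := le_trans hphi (ler_wpM2l (ltW (expR_gt0 _)) hs).
  have hj := large_jump_le delta xi s0.
  have hj' : (if `|xi| <= delta then 0 else C1 * expR (kap * `|xi|)) <=
     tail * (expR ((kap + s) * xi) + expR (- (kap + s) * xi)).
    rewrite /tail -mulrA; apply: le_trans (ler_wpM2l C10 hj).
    by case: ifP; rewrite ?mulr0.
  have {hs} : phi z <= e * (interp mu sigma a lambda (V k M) (V k.+1 (M - a)) (M - X - xi) +
       eta * (barrier k (M - X) + expR xi - 1) +
       tail * (expR ((kap + s) * xi) + expR (- (kap + s) * xi))).
    apply: (le_trans hs); rewrite -/e ler_wpM2l ?expR_ge0//.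
    by rewrite lerD2l.
  have -> : interp mu sigma a lambda (V k M) (V k.+1 (M - a)) (M - X - xi) =
     w1 * expR (- bp * y) * expR (bp * xi) + w2 * expR (- bm * y) * expR (bm * xi).
    rewrite /interp -/w1 -/w2 -(mulrA w1) -(mulrA w2) -(expRD (- bp * y)) -(expRD (- bm * y)).
    by congr (_ * expR _ + _ * expR _); rewrite /y; ring.
  have E1 : expR xi = drift 1 * expR (1 * sigma * z) by rewrite dE mul1r.
  rewrite E1 -!dE -/y.
  by lra.
apply: (@le_trans _ _ (\int[nu]_z
    (\sum_(p <- l) p.1 * expR (p.2 * z))%:E)%E).
  apply: ge0_le_integral => //.
  - by move=> z _; rewrite lee_fin.
  - by apply/measurable_EFinP; apply: measurable_funD.
  - exact: measurable_int il.
  - by move=> z _; rewrite lee_fin.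
rewrite El lee_fin /l !big_cons big_nil /= expr0n /= !mul0r expR0 mulr1 addr0.
have dE t : drift t * expR ((t * sigma) ^+ 2 * h / 2) = increment_mgf h t.
  by rewrite /drift -expRD.
have valE : supersol eta k M X =
    w1 * expR (- bp * y) + w2 * expR (- bm * y) + eta * barrier k y.
  by rewrite /supersol /value kn.
set L := (X in X <= _).
have -> : L = e * (w1 * expR (- bp * y) * increment_mgf h bp +
    w2 * expR (- bm * y) * increment_mgf h bm + eta * (barrier k y - 1) +
    eta * increment_mgf h 1 + C1 * (expR (- (s * delta)) *
     (increment_mgf h (kap + s) + increment_mgf h (- (kap + s))))) + C0.
  by rewrite /L -!dE /tail; ring.
rewrite increment_mgf_plus increment_mgf_minus valE lerD2r.
have eE : e * expR (lambda * h) = 1 by rewrite /e expRN mulVf// gt_eqF// expR_gt0.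
have m1 := increment_mgf1_le hpos h1.
set J := C1 * _ in jump_le *; set m := increment_mgf h 1 in m1 *.
set B := barrier k y; set g := expR (lambda * h) in eE *.
have BK : barrier_const mu sigma a lambda - a <= B.
  by apply: barrier_ge => //; case/andP: yr => _ /ltW.
have gB : B + (1 + exp_drift mu sigma) * h <= g * B.
  have hB : 0 <= B.
    by rewrite (le_trans _ BK)// subr_ge0 barrier_const_ge.
  have : (1 + lambda * h) * B <= g * B by rewrite ler_wpM2r// expR_ge1Dx.
  have : lambda * h * (barrier_const mu sigma a lambda - a) <= lambda * h * B.
    by rewrite ler_wpM2l// mulr_ge0 ?ltW.
  rewrite mulrAC (barrier_const_gt _ _ _ lambda_gt0).
  by lra.
have : e * (eta * (B - 1) + eta * m + J) <= e * (eta * (g * B)).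
  rewrite ler_wpM2l ?expR_ge0//.
  have : eta * m <= eta * (1 + exp_drift mu sigma * h) by rewrite ler_wpM2l// ltW.
  have : eta * (B + (1 + exp_drift mu sigma) * h) <= eta * (g * B).
    by rewrite ler_wpM2l// ltW.
  by lra.
have -> : e * (eta * (g * B)) = (e * g) * (eta * B) by ring.
rewrite eE mul1r => hh'.
set p := w1 * _; set q := w2 * _.
have -> : e * (p * g + q * g + eta * (B - 1) + eta * m + J) =
    (e * g) * (p + q) + e * (eta * (B - 1) + eta * m + J) by ring.
by rewrite eE mul1r lerD2l.
Qed.

End SupersolutionMean.

(** * The drawdown chain *)

Section MarkovChain.
Local Open Scope ereal_scope.
Context (d dS : measure_display) (T : measurableType d) (S : measurableType dS)
  (R : realType) (P : probability T R) (nu : probability R R).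
Context (F : S * R -> S) (mF : measurable_fun setT F).
Context (xi : nat -> T -> R) (mxi : forall i, measurable_fun setT (xi i)).
Context (s0 : S) (N : nat).

Fixpoint chain (j : nat) (w : T) : S :=
  if j is i.+1 then F (chain i w, xi i w) else s0.

Lemma measurable_chain j : measurable_fun setT (chain j).
Proof.
elim: j => [|j IH] /=; first exact: measurable_cst.
apply: (measurableT_comp (f := F) (g := fun w => (chain j w, xi j w))) => //.
exact: measurable_fun_pair.
Qed.

Let tail (B : nat -> set R) (j : nat) : set T :=
  [set w | forall i, (j <= i < N)%N -> B i (xi i w)].

Let measurable_tail B j : (forall i, measurable (B i)) -> measurable (tail B j).
Proof.
move=> mB; have -> : tail B j = \bigcap_(i in [set i | (j <= i < N)%N]) (xi i @^-1` B i).
  by apply/seteqP; split=> w h i; apply: h.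
by apply: bigcap_measurableType => i _; rewrite -[X in measurable X]setTI; exact: mxi.
Qed.

Hypothesis indep : forall B : nat -> set R, (forall i, measurable (B i)) ->
  P [set w | forall i, (i < N)%N -> B i (xi i w)] = \prod_(i < N) nu (B i).

Let tailS B j : (j < N)%N -> tail B j = xi j @^-1` B j `&` tail B j.+1.
Proof.
move=> jN; apply/seteqP; split => w.
  move=> h; split; first by apply: h; rewrite leqnn.
  by move=> i /andP[ji iN]; apply: h; rewrite (ltnW ji).
move=> [h1 h2] i /andP[]; rewrite leq_eqVlt => /orP[/eqP <- //|ji iN].
by apply: h2; rewrite ji.
Qed.

Lemma tail_prod B j : (forall i, measurable (B i)) -> (j <= N)%N ->
  P (tail B j) = \prod_(j <= i < N) nu (B i).
Proof.
move=> mB jN; pose B' i := if (i < j)%N then setT else B i.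
have -> : tail B j = tail B' 0.
  apply/seteqP; split => w h i.
    move=> /andP[_ iN]; rewrite /B'; case: ltnP => // ji; apply: h.
    by rewrite ji.
  move=> /andP[ji iN]; by have := h i iN; rewrite /B' ltnNge ji.
rewrite [LHS]indep; last by move=> i; rewrite /B'; case: ifP.
rewrite -(big_mkord xpredT (fun i => nu (B' i))) (big_cat_nat (n := j))//=.
rewrite big_nat big1 ?mul1e; last first.
  by move=> i /andP[_ ij]; rewrite /B' ij probability_setT.
by apply: eq_big_nat => i /andP[ji _]; rewrite /B' ltnNge ji.
Qed.

Let chain_mfun j : {mfun T >-> S} :=
  HB.pack (chain j) (isMeasurableFun.Build _ _ _ _ (chain j) (measurable_chain j)).

Let joint j : T -> S * R := fun w => (chain j w, xi j w).

Let mjoint j : measurable_fun setT (joint j).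
Proof. by apply: measurable_fun_pair => //; exact: measurable_chain. Qed.

Let joint_mfun j : {mfun T >-> (S * R)%type} :=
  HB.pack (joint j) (isMeasurableFun.Build _ _ _ _ (joint j) (mjoint j)).

Let law j : probability S R := distribution P (chain_mfun j).

(** For fixed [B] both sides are measures in [D]: the law of [joint j] restricted to the future
    event, and a product measure scaled by the probability of that event. The assumed factorisation
    makes them agree on rectangles, hence everywhere. *)
Lemma chain_joint j D B : (j < N)%N -> (forall i, measurable (B i)) ->
  (forall A B', measurable A -> (forall i, measurable (B' i)) ->
    P (chain j @^-1` A `&` tail B' j) = P (chain j @^-1` A) * P (tail B' j)) ->
  measurable D ->
  P (joint j @^-1` D `&` tail B j.+1) = (law j \x nu) D * P (tail B j.+1).
Proof.
move=> jN mB IH mD.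
have mE := measurable_tail j.+1 mB.
have cP : (0 <= fine (P (tail B j.+1)))%R by rewrite fine_ge0.
pose c := NngNum cP.
have cE : c%:num%:E = P (tail B j.+1) by rewrite /= fineK// fin_num_measure.
pose m1 : {sigma_finite_measure set S -> \bar R} := mscale c (law j).
pose m' : {measure set (S * R) -> \bar R} :=
  measure_function_pushforward__canonical__measure_function_Measure
    (mrestr P mE) (mjoint j).
have rect A B0 : measurable A -> measurable B0 -> m' (A `*` B0) = m1 A * nu B0.
  move=> mA mB0; pose B' i := if i == j then B0 else B i.
  have mB' i : measurable (B' i) by rewrite /B'; case: ifP.
  have tE : tail B' j = xi j @^-1` B0 `&` tail B j.+1.
    rewrite tailS// {1}/B' eqxx; congr (_ `&` _).
    apply/seteqP; split => w h i /andP[ji iN]; have := h i; rewrite ji iN;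
      by rewrite /B' gtn_eqF// => /(_ isT).
  rewrite [LHS](_ : _ = P (chain j @^-1` A `&` tail B' j)); last first.
    by rewrite tE setIA.
  rewrite IH// tail_prod// ?(ltnW jN)// big_ltn// {1}/B' eqxx.
  rewrite /m1 /= /mscale cE tail_prod//.
  rewrite (eq_big_nat _ _ (F2 := fun i => nu (B i))); last first.
    by move=> i /andP[ji _]; rewrite /B' gtn_eqF.
  by rewrite muleC [nu B0 * _]muleC [RHS]muleAC.
have := product_measure_unique rect mD.
rewrite /m' /= /pushforward /mrestr /= => <-.
rewrite /product_measure1 ge0_integral_mscale//; last first.
  exact: measurable_fun_xsection.
by rewrite cE muleC.
Qed.

Lemma chain_tail j A B : (j <= N)%N -> measurable A ->
  (forall i, measurable (B i)) ->
  P (chain j @^-1` A `&` tail B j) = P (chain j @^-1` A) * P (tail B j).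
Proof.
elim: j A B => [|j IH] A B jN mA mB.
  have [As0|As0] := pselect (A s0).
    have -> : chain 0 @^-1` A = setT by apply/seteqP; split.
    by rewrite setTI probability_setT mul1e.
  have -> : chain 0 @^-1` A = set0 by apply/seteqP; split.
  by rewrite set0I measure0 mul0e.
have mFA : measurable (F @^-1` A) by rewrite -[X in measurable X]setTI; exact: mF.
have mT (i : nat) : measurable ((fun=> setT) i : set R) by [].
have IH' A' B' : measurable A' -> (forall i, measurable (B' i)) ->
    P (chain j @^-1` A' `&` tail B' j) = P (chain j @^-1` A') * P (tail B' j).
  by apply: IH; exact: ltnW.
have -> : chain j.+1 @^-1` A = joint j @^-1` (F @^-1` A) by [].
rewrite chain_joint//; congr (_ * _).
have := chain_joint (B := fun=> setT) jN mT IH' mFA.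
have -> : tail (fun=> setT) j.+1 = setT by apply/seteqP; split.
by rewrite setIT probability_setT mule1.
Qed.

Lemma chain_law j D : (j < N)%N -> measurable D ->
  P (joint j @^-1` D) = (law j \x nu) D.
Proof.
move=> jN mD; have mT (i : nat) : measurable ((fun=> setT) i : set R) by [].
have IH A' B' : measurable A' -> (forall i, measurable (B' i)) ->
    P (chain j @^-1` A' `&` tail B' j) = P (chain j @^-1` A') * P (tail B' j).
  by apply: chain_tail; exact: ltnW.
have := chain_joint (B := fun=> setT) jN mT IH mD.
have -> : tail (fun=> setT) j.+1 = setT by apply/seteqP; split.
by rewrite setIT probability_setT mule1.
Qed.

(** The product law of the state and the next increment lets Tonelli integrate over the increment
    alone, in place of a conditional expectation. *)
Lemma chain_supermartingale (f : S -> R) : measurable_fun setT f ->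
  (forall s, 0 <= f s)%R ->
  (forall s, \int[nu]_z (f (F (s, z)))%:E <= (f s)%:E) ->
  forall j, (j <= N)%N -> \int[P]_w (f (chain j w))%:E <= (f s0)%:E.
Proof.
move=> mf f0 super; elim=> [|j IH] jN.
  by rewrite /= integral_cst// [X in _ * X](_ : _ = 1) ?mule1//; exact: probability_setT.
have mfE : measurable_fun setT (fun s => (f s)%:E) by exact/measurable_EFinP.
have mfF : measurable_fun setT (fun p => (f (F p))%:E).
  by apply/measurable_EFinP; exact: measurableT_comp.
apply: le_trans (IH (ltnW jN)).
have -> : \int[P]_w (f (chain j.+1 w))%:E =
    \int[distribution P (joint_mfun j)]_p (f (F p))%:E.
  rewrite ge0_integral_distribution// => p; by rewrite lee_fin.
have -> : \int[distribution P (joint_mfun j)]_p (f (F p))%:E =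
    \int[law j \x nu]_p (f (F p))%:E.
  by apply: eq_measure_integral => D mD _; exact: chain_law.
rewrite fubini_tonelli1//; last by move=> p; rewrite lee_fin.
have -> : \int[P]_w (f (chain j w))%:E = \int[law j]_s (f s)%:E.
  by rewrite ge0_integral_distribution// => p; rewrite lee_fin.
apply: ge0_le_integral => //.
- by move=> s _; apply: integral_ge0 => z _; rewrite lee_fin.
- by apply: measurable_fun_fubini_tonelli_F => // p; rewrite lee_fin.
- by move=> s _; exact: super.
Qed.

End MarkovChain.

Section DrawdownChain.
Context (R : realType) (mu sigma a lambda : R).
Hypotheses (sigma_gt0 : 0 < sigma) (a_gt0 : 0 < a) (lambda_gt0 : 0 < lambda).
Implicit Types h z M X eta : R.

(* A state ((j, k), (M, X)) records the number j of steps made before the n-th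
   drawdown, the number k of drawdowns, the maximum M since the last drawdown
   and the position X.  The chain is frozen once k = n; it is also frozen in the
   unreachable states where M - X is not in [0, a). *)
Definition state : Type := ((nat * nat) * (R * R))%type.

Definition active (n : nat) (s : state) : bool :=
  (s.1.2 < n)%N && (0 <= s.2.1 - s.2.2 < a).

Definition chain_step (n : nat) h (p : state * R) : state :=
  if active n p.1 then
    let s := drawdown_step a p.1.1.2 p.1.2.1 (p.1.2.2 + (mu * h + sigma * p.2)) in
    ((p.1.1.1.+1, s.1), s.2)
  else p.1.

Definition init_state : state := ((0%N, 0%N), (0, 0)).

Lemma measurable_active n : measurable_fun setT (active n).
Proof.
apply: measurable_and.
  by apply: (measurableT_comp (f := fun k : nat => (k < n)%N)
    (g := fun s : state => s.1.2)) => //; apply: measurableT_comp.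
have mD : measurable_fun setT (fun s : state => s.2.1 - s.2.2).
  by apply: measurable_funB; apply: measurableT_comp.
by apply: measurable_and; [exact: measurable_fun_ler|exact: measurable_fun_ltr].
Qed.

Lemma measurable_chain_step n h : measurable_fun setT (chain_step n h).
Proof.
have m1 : measurable_fun setT (fun p : state * R => p.1) := measurable_fst.
have mjk : measurable_fun setT (fun p : state * R => p.1.1).
  exact: measurableT_comp.
have mj : measurable_fun setT (fun p : state * R => p.1.1.1).
  exact: measurableT_comp.
have mk : measurable_fun setT (fun p : state * R => p.1.1.2).
  exact: measurableT_comp.
have mMX : measurable_fun setT (fun p : state * R => p.1.2).
  exact: measurableT_comp.
have mM : measurable_fun setT (fun p : state * R => p.1.2.1).
  exact: measurableT_comp.
have mX : measurable_fun setT (fun p : state * R => p.1.2.2).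
  exact: measurableT_comp.
have mX' : measurable_fun setT
    (fun p : state * R => p.1.2.2 + (mu * h + sigma * p.2)).
  apply: measurable_funD => //; apply: measurable_funD => //.
  exact: measurable_funM.
have mS (g : state * R -> nat) : measurable_fun setT g ->
    measurable_fun setT (fun p => (g p).+1).
  by move=> mg; apply: (measurableT_comp (f := S) (g := g)).
rewrite (_ : chain_step n h = fun p : state * R => if active n p.1 then
  if a <= p.1.2.1 - (p.1.2.2 + (mu * h + sigma * p.2)) then
    ((p.1.1.1.+1, p.1.1.2.+1), (p.1.2.2 + (mu * h + sigma * p.2),
      p.1.2.2 + (mu * h + sigma * p.2)))
  else ((p.1.1.1.+1, p.1.1.2), (Num.max p.1.2.1 (p.1.2.2 + (mu * h + sigma * p.2)),
      p.1.2.2 + (mu * h + sigma * p.2)))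
  else p.1); last first.
  apply/funext => p; rewrite /chain_step /drawdown_step.
  by case: ifP => // _; case: ifP.
apply: measurable_fun_ifT => //.
  apply: (measurableT_comp (f := active n) (g := fst)) => //.
  exact: measurable_active.
apply: measurable_fun_ifT.
- by apply: measurable_fun_ler => //; exact: measurable_funB.
- apply: measurable_fun_pair; apply: measurable_fun_pair => //.
  + exact: mS.
  + exact: mS.
- apply: measurable_fun_pair; apply: measurable_fun_pair => //.
  + exact: mS.
  + exact: measurable_maxr.
Qed.

(** [nat] is countable and discrete, so a preimage splits into countably many slices. *)
Lemma measurable_fun_natX d d' (T : measurableType d) (U : measurableType d')
    (g : nat -> T -> U) : (forall k, measurable_fun setT (g k)) ->
  measurable_fun setT (fun p : nat * T => g p.1 p.2).
Proof.
move=> mg _ Y mY; rewrite setTI.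
have -> : (fun p : nat * T => g p.1 p.2) @^-1` Y =
    \bigcup_k ([set k] `*` (g k @^-1` Y)).
  apply/seteqP; split => [[k t] /= Yg|[k t] [k' _ [/= -> ]]//].
  by exists k.
apply: bigcup_measurable => k _; apply: measurableX => //.
by rewrite -[X in measurable X]setTI; exact: mg.
Qed.

Lemma measurable_state_fun d' (U : measurableType d') (g : nat -> nat -> R -> R -> U) :
  (forall j k, measurable_fun setT (fun p : R * R => g j k p.1 p.2)) ->
  measurable_fun setT (fun s : state => g s.1.1 s.1.2 s.2.1 s.2.2).
Proof.
move=> mg.
have m1 := measurable_fun_natX (fun j => measurable_fun_natX (mg j)).
apply: (measurableT_comp m1 (g := fun s : state => (s.1.1, (s.1.2, s.2)))).
by apply: measurable_fun_pair; [|apply: measurable_fun_pair];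
  rewrite //; apply: measurableT_comp.
Qed.

End DrawdownChain.

(** * Discounted rewards of the chain *)

Section DiscountedReward.
Context (R : realType) (mu sigma a lambda : R).
Hypotheses (sigma_gt0 : 0 < sigma) (a_gt0 : 0 < a) (lambda_gt0 : 0 < lambda).
Implicit Types h z M X eta : R.
Context (n : nat) (V : nat -> R -> R) (C : R).
Hypothesis HV : level_values mu sigma a lambda n V C.

Local Notation ssol := (supersol mu sigma a lambda n V).
Local Notation chain_step := (chain_step mu sigma a n).

Lemma measurable_level k : (k <= n)%N -> measurable_fun setT (V k).
Proof.
move=> kn; have C0 := level_ge0 HV.
have lip x y : `|V k x - V k y| <= C * `|x - y|.
  wlog xy : x y / x <= y => [hw|].
    have [|/ltW] := leP x y; first exact: hw.
    by move=> /hw; rewrite distrC [`|y - x|]distrC.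
  have yx0 : 0 <= y - x by rewrite subr_ge0.
  have := level_lipschitz HV y kn yx0.
  by rewrite subKr [`|x - y|]distrC (ger0_norm yx0).
apply: continuous_measurable_fun => x; apply/cvgrPdist_lt => e e0.
have C1 : 0 < C + 1 by exact: ltr_wpDl.
near=> t; apply: le_lt_trans (lip x t) _.
have : `|x - t| < e / (C + 1).
  by near: t; apply: cvgr_dist_lt => //; rewrite divr_gt0.
rewrite ltr_pdivlMr// => /(le_lt_trans _); apply.
by rewrite mulrC ler_wpM2l// lerDl.
Unshelve. all: by end_near.
Qed.

(** [C0] will bound [supersol] on the valid states, so that the potential is nonnegative there, as
    Tonelli requires; on the other, unreachable states it is set to 0. *)
Definition potential eta C0 h (j k : nat) M X : R :=
  if (k < n)%N && ~~ (0 <= M - X < a) then 0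
  else expR (- (lambda * h * j%:R)) * ssol eta k M X + C0.

Lemma measurable_supersol eta k :
  measurable_fun setT (fun p : R * R => ssol eta k p.1 p.2).
Proof.
have mV i (g : R * R -> R) : (i <= n)%N -> measurable_fun setT g ->
    measurable_fun setT (fun p => V i (g p)).
  by move=> iN mg; exact: measurableT_comp (measurable_level iN) mg.
have mdiff : measurable_fun setT (fun p : R * R => p.1 - p.2).
  exact: measurable_funB.
rewrite /supersol; apply: measurable_funD.
  have [kn|kn] := boolP (k < n)%N; rewrite /value ?kn ?(negbTE kn)//; last exact: mV.
  have m0 := mV k _ (ltnW kn) measurable_fst.
  have m1 : measurable_fun setT (fun p : R * R => V k.+1 (p.1 - a)).
    by apply: mV => //; exact: measurable_funB.
  rewrite /interp /wplus /wminus; apply: measurable_funD; apply: measurable_funM.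
  - apply: measurable_funM => //; apply: measurable_funB => //.
    exact: measurable_funM.
  - by apply: measurableT_comp => //; exact: measurable_funM.
  - apply: measurable_funM => //; apply: measurable_funB => //.
    exact: measurable_funM.
  - by apply: measurableT_comp => //; exact: measurable_funM.
apply: measurable_funM => //; rewrite /barrier.
have [kn|kn] := boolP (k < n)%N; rewrite ?(negbTE kn)//.
by apply: measurable_funD => //; exact: measurable_funB.
Qed.

Lemma measurable_potential eta C0 h :
  measurable_fun setT
    (fun s : state R => potential eta C0 h s.1.1 s.1.2 s.2.1 s.2.2).
Proof.
apply: (measurable_state_fun (g := potential eta C0 h)) => j k; rewrite /potential.
have mdiff : measurable_fun setT (fun p : R * R => p.1 - p.2).
  exact: measurable_funB.
apply: measurable_fun_ifT => //.
  apply: measurable_and => //; apply: measurable_neg.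
  by apply: measurable_and; [exact: measurable_fun_ler|exact: measurable_fun_ltr].
by apply: measurable_funD => //; apply: measurable_funM => //; exact: measurable_supersol.
Qed.

Definition barrier_bound : R := barrier_const mu sigma a lambda + n%:R * (a + 1).

Lemma supersol_bounded eta : 0 < eta -> exists2 C0 : R, 0 <= C0 &
  forall k M X, ((k < n)%N -> 0 <= M - X < a) -> `|ssol eta k M X| <= C0.
Proof.
move=> eta0; have [B [B0 HB]] := value_le sigma_gt0 a_gt0 lambda_gt0 HV.
have bb0 : 0 <= barrier_bound.
  apply: addr_ge0; first by rewrite (le_trans (ltW a_gt0))// barrier_const_ge.
  by rewrite mulr_ge0// addr_ge0// ltW.
exists (B + eta * barrier_bound).
  by rewrite addr_ge0// mulr_ge0// ltW.
move=> k M X yr; rewrite /supersol (le_trans (ler_normD _ _))// lerD ?HB//.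
rewrite normrM (gtr0_norm eta0) ler_wpM2l ?(ltW eta0)//.
have bK := barrier_const_ge mu sigma a lambda_gt0.
have [kn|kn] := boolP (k < n)%N; last first.
  rewrite /barrier (negbTE kn) ger0_norm; last first.
    by rewrite (le_trans (ltW a_gt0))// barrier_const_ge.
  by rewrite lerDl mulr_ge0// addr_ge0// ltW.
have /andP[y0 ya] := yr kn.
rewrite ger0_norm; first exact: barrier_le.
apply: le_trans (barrier_ge _ _ _ _ _ _ (ltW ya)) => //.
by rewrite subr_ge0.
Qed.

Definition valid (s : state R) : Prop :=
  (s.1.2 <= n)%N /\ ((s.1.2 < n)%N -> 0 <= s.2.1 - s.2.2 < a).

Lemma chain_stepE h s z : active a n s ->
  chain_step h (s, z) =
  let t := drawdown_step a s.1.2 s.2.1 (s.2.2 + (mu * h + sigma * z)) in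
  ((s.1.1.+1, t.1), t.2).
Proof. by rewrite /chain_step => ->. Qed.

Lemma chain_step_frozen h s z : ~~ active a n s -> chain_step h (s, z) = s.
Proof. by rewrite /chain_step => /negbTE ->. Qed.

Lemma valid_step h s z : valid s -> valid (chain_step h (s, z)).
Proof.
move=> vs; have [as_|/chain_step_frozen -> //] := boolP (active a n s).
rewrite chain_stepE//; move: as_; rewrite /active => /andP[kn yr].
rewrite /valid /drawdown_step; set X' := _ + (_ + _).
have [_|lt_a] := leP a (s.2.1 - X') => /=; first by rewrite subrr lexx.
rewrite (ltnW kn) subr_ge0 le_max lexx orbT /=; split => // _.
by rewrite ltrBlDr gt_max -!ltrBlDr lt_a subrr.
Qed.

Lemma potential_super eta C0 h (nu : probability R R) : 0 < eta -> 0 <= C0 ->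
  0 < h ->
  (forall k M X, ((k < n)%N -> 0 <= M - X < a) -> `|ssol eta k M X| <= C0) ->
  (forall k M X C0 (phi : R -> R), (k < n)%N -> 0 <= M - X < a ->
    measurable_fun setT phi -> (forall z, 0 <= phi z + C0) ->
    (forall z, let s := drawdown_step a k M (X + (mu * h + sigma * z)) in
      phi z <= expR (- (lambda * h)) * ssol eta s.1 s.2.1 s.2.2) ->
    (\int[nu]_z (phi z + C0)%:E <= (ssol eta k M X + C0)%:E)%E) ->
  forall s : state R,
  (\int[nu]_z (let s' := chain_step h (s, z) in
     potential eta C0 h s'.1.1 s'.1.2 s'.2.1 s'.2.2)%:E <=
   (potential eta C0 h s.1.1 s.1.2 s.2.1 s.2.2)%:E)%E.
Proof.
move=> eta0 C00 h0 bnd mean s.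
have [act|inact] := boolP (active a n s); last first.
  under eq_integral do rewrite chain_step_frozen//.
  rewrite integral_cst// [X in (_ * X <= _)%E](_ : _ = 1%E) ?mule1//.
  exact: probability_setT.
have [kn yr] := andP act.
set q := expR (- (lambda * h * s.1.1%:R)).
have q0 : 0 < q by exact: expR_gt0.
pose S z := drawdown_step a s.1.2 s.2.1 (s.2.2 + (mu * h + sigma * z)).
pose phi z := expR (- (lambda * h)) * ssol eta (S z).1 (S z).2.1 (S z).2.2.
have vS z : ((S z).1 < n)%N -> 0 <= (S z).2.1 - (S z).2.2 < a.
  have vs : valid s by split => //; exact: ltnW.
  by have := valid_step h z vs; rewrite chain_stepE// => -[].
(* Dividing by the discount [q] accumulated so far reduces the claim to a single step with shift
   [C0 / q]; for this the hypothesis on the mean admits any shift. *)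
have potE z : (let s' := chain_step h (s, z) in
     potential eta C0 h s'.1.1 s'.1.2 s'.2.1 s'.2.2) = q * (phi z + C0 / q).
  rewrite chain_stepE//= /potential -/(S z).
  rewrite ifF; last by apply/negbTE/negP => /andP[/vS ->].
  rewrite [RHS]mulrDr [q * (C0 / q)]mulrC divfK ?gt_eqF//; congr (_ + _).
  rewrite /phi mulrA; congr (_ * _); rewrite /q -expRD -natr1.
  by congr expR; ring.
under eq_integral do rewrite potE EFinM.
have mphi : measurable_fun setT phi.
  apply: measurable_funM => //.
  have mss : measurable_fun setT
      (fun t : state R => ssol eta t.1.2 t.2.1 t.2.2).
    apply: (measurable_state_fun (g := fun _ k M X => ssol eta k M X)) => _ k.
    exact: measurable_supersol.
  rewrite (_ : (fun z => _) = (fun t : state R => ssol eta t.1.2 t.2.1 t.2.2) \o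
    (chain_step h \o pair s)); last by apply/funext => z /=; rewrite chain_stepE.
  apply: measurableT_comp => //; apply: measurableT_comp => //.
  exact: measurable_chain_step.
have phi0 z : 0 <= phi z + C0 / q.
  have e1 : expR (- (lambda * h)) <= 1.
    by rewrite -expR0 ler_expR oppr_le0 mulr_ge0// ltW.
  have := bnd _ _ _ (vS z) => /lerNnormlW hb.
  have : 0 <= q * (phi z + C0 / q).
    rewrite -potE chain_stepE//= /potential -/(S z).
    rewrite ifF; last by apply/negbTE/negP => /andP[/vS ->].
    have e2 : expR (- (lambda * h * s.1.1.+1%:R)) <= 1.
      by rewrite -expR0 ler_expR oppr_le0 !mulr_ge0// ltW.
    have := expR_ge0 (- (lambda * h * s.1.1.+1%:R)); nra.
  by rewrite pmulr_rge0.
rewrite ge0_integralZl//; first last.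
- by rewrite lee_fin ltW.
- by move=> z _; rewrite lee_fin.
- by apply/measurable_EFinP; exact: measurable_funD.
have -> : potential eta C0 h s.1.1 s.1.2 s.2.1 s.2.2 =
    q * (ssol eta s.1.2 s.2.1 s.2.2 + C0 / q).
  rewrite /potential kn yr /= [RHS]mulrDr [q * (C0 / q)]mulrC divfK ?gt_eqF//.
rewrite EFinM lee_pmul2l ?lte_fin//.
exact: mean.
Qed.

End DiscountedReward.

Section RewardLimit.
Context (R : realType) (mu sigma a lambda : R).
Hypotheses (sigma_gt0 : 0 < sigma) (a_gt0 : 0 < a) (lambda_gt0 : 0 < lambda).
Context (n : nat) (n_gt0 : (0 < n)%N).
Context (d : measure_display) (T : measurableType d) (P : probability T R).

Local Notation pchain h xi := (chain (chain_step mu sigma a n h) xi (init_state R)).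

Definition discount_factor (h : R) (s : state R) : R :=
  if s.1.2 == n then expR (- (lambda * h * s.1.1%:R)) else 0.

Lemma discount_factor_ge0 h s : 0 <= discount_factor h s.
Proof. by rewrite /discount_factor; case: ifP => // _; exact: expR_ge0. Qed.

Lemma discount_factor_le1 h s : 0 <= h -> discount_factor h s <= 1.
Proof.
move=> h0; rewrite /discount_factor; case: ifP => // _.
by rewrite -expR0 ler_expR oppr_le0 !mulr_ge0// ltW.
Qed.

Lemma measurable_discount_factor h : measurable_fun setT (discount_factor h).
Proof.
apply: (measurable_state_fun
  (g := fun j k _ _ => if k == n then expR (- (lambda * h * j%:R)) else 0)).
by move=> j k; exact: measurable_cst.
Qed.

(** Until the n-th drawdown the chain is never frozen, so an unfinished chain carries the discount
    of the full horizon. *)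
Lemma valid_chain h (xi : nat -> T -> R) N w :
  valid a n (pchain h xi N w) /\
  (((pchain h xi N w).1.2 < n)%N -> (pchain h xi N w).1.1 = N).
Proof.
elim: N => [|N [v jN]] /=; first by split=> //; split => //= _; rewrite subrr lexx.
split; first exact: valid_step.
have [act|inact] := boolP (active a n (pchain h xi N w)); last first.
  rewrite chain_step_frozen// => kn; case/negP: inact.
  by rewrite /active kn; case: v => _ ->.
by rewrite chain_stepE//= jN//; case/andP: act.
Qed.

Context (V : nat -> R -> R) (C : R).
Hypothesis HV : level_values mu sigma a lambda n V C.

Definition increments_spec (h : R) (nu : probability R R) (xi : nat -> T -> R) N :=
  [/\ forall t, (\int[nu]_z (expR (t * z))%:E = (expR (t ^+ 2 * h / 2))%:E)%E,
      forall i, measurable_fun setT (xi i) &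
      forall B : nat -> set R, (forall i, measurable (B i)) ->
        P [set w | forall i, (i < N)%N -> B i (xi i w)] =
          (\prod_(i < N) nu (B i))%E].

Lemma reward_integrable h (S : T -> state R) : 0 <= h -> measurable_fun setT S ->
  P.-integrable setT (fun w => (discount_factor h (S w) * V n (S w).2.2)%:E).
Proof.
move=> h0 mS; have m1 : measurable_fun setT (fun w => discount_factor h (S w)).
  by apply: measurableT_comp mS; exact: measurable_discount_factor.
have m2 : measurable_fun setT (fun w => V n (S w).2.2).
  apply: measurableT_comp; first exact: (measurable_level HV).
  by do 2 apply: measurableT_comp => //.
apply: measurable_bounded_integrable => //.
- exact: le_lt_trans (probability_le1 P measurableT) (ltry 1).
- exact: measurable_funM.
exists C; split; first exact: num_real.
move=> M /ltW CM w _ /=; apply: le_trans CM.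
rewrite normrM (ger0_norm (discount_factor_ge0 _ _)).
have := level_bound HV (S w).2.2 (leqnn n); apply: le_trans.
by rewrite ler_piMl// discount_factor_le1.
Qed.

(** The last term covers the paths with fewer than n drawdowns by the horizon: their reward is 0,
    but the supersolution may be as low as [- C0] there. *)
Lemma reward_upper eta : 0 < eta -> exists2 h0 : R, 0 < h0 &
  exists2 C0 : R, 0 <= C0 & forall h nu xi N, 0 < h < h0 ->
    increments_spec h nu xi N ->
    (\int[P]_w (discount_factor h (pchain h xi N w) *
       V n (pchain h xi N w).2.2)%:E <=
     (V 0%N 0 + eta * barrier_bound mu sigma a lambda n +
       C0 * expR (- (lambda * h * N%:R)))%:E)%E.
Proof.
move=> eta0.
have [h0 /andP[h00 _] mean] := supersol_mean sigma_gt0 a_gt0 lambda_gt0 HV eta0.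
have [C0 C00 bnd] := supersol_bounded sigma_gt0 a_gt0 lambda_gt0 HV eta0.
exists h0 => //; exists C0 => // h nu xi N hh [mgf mxi indep].
have hpos : 0 < h by case/andP: hh.
pose S w := pchain h xi N w.
pose pot (s : state R) := potential mu sigma a lambda n V eta C0 h s.1.1 s.1.2 s.2.1 s.2.2.
have mpot : measurable_fun setT pot by exact: measurable_potential HV _ _ _.
have mS : measurable_fun setT S by apply: measurable_chain => //; exact: measurable_chain_step.
have pot0 s : 0 <= pot s.
  rewrite /pot /potential; case: ifP => // /negbT.
  rewrite negb_and negbK => vs.
  have e1 : expR (- (lambda * h * s.1.1%:R)) <= 1.
    by rewrite -expR0 ler_expR oppr_le0 !mulr_ge0// ltW.
  have := bnd s.1.2 s.2.1 s.2.2; case: (s.1.2 < n)%N vs => /= vs.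
    by move=> /(_ (fun=> vs)) /lerNnormlW; have := expR_ge0 (- (lambda * h * s.1.1%:R)); nra.
  by move=> /(_ (fun f => False_ind _ (notF f))) /lerNnormlW;
    have := expR_ge0 (- (lambda * h * s.1.1%:R)); nra.
have main : (\int[P]_w (pot (S w))%:E <= (pot (init_state R))%:E)%E.
  have mF := measurable_chain_step mu sigma a n h.
  have super s : (\int[nu]_z (pot (chain_step mu sigma a n h (s, z)))%:E <=
      (pot s)%:E)%E.
    apply: (potential_super a_gt0 lambda_gt0 HV eta0 C00 hpos bnd).
    by move=> k M X C1 phi kn yr mphi phi0 phi_le; exact: (mean h nu).
  exact: (chain_supermartingale mF mxi (init_state R) indep mpot pot0 super (leqnn N)).
have initE : pot (init_state R) <= V 0%N 0 + eta * barrier_bound mu sigma a lambda n + C0.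
  rewrite /pot /potential /= n_gt0 subrr lexx a_gt0 /= mulr0 oppr0 expR0 mul1r lerD2r.
  rewrite /supersol value_reset// lerD2l ler_wpM2l ?(ltW eta0)// subrr.
  exact: barrier_le.
pose r w := discount_factor h (S w) * V n (S w).2.2.
have ir : P.-integrable setT (EFin \o r).
  by apply: reward_integrable => //; exact: ltW.
pose e := expR (- (lambda * h * N%:R)).
pose c1 := C0 * (1 - e).
have ic1 : P.-integrable setT (EFin \o cst c1).
  by apply: finite_measure_integrable_cst.
have r_le w : r w + c1 <= pot (S w).
  have [vS jN] := valid_chain h xi N w; rewrite -/(S w) in vS jN.
  rewrite /r /c1 /pot /potential /discount_factor; case: vS => kn.
  rewrite leq_eqVlt in kn; case/orP: kn => [/eqP kn _|kn yr].
    rewrite kn eqxx ltnn /= /supersol /value ltnn /barrier ltnn.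
    set q := expR _; rewrite [q * (_ + _)]mulrDr.
    have : 0 <= q * (eta * barrier_const mu sigma a lambda).
      rewrite !mulr_ge0 ?expR_ge0 ?(ltW eta0)//.
      by rewrite (le_trans (ltW a_gt0))// barrier_const_ge.
    have : 0 <= C0 * e by rewrite mulr_ge0// expR_ge0.
    by lra.
  rewrite kn yr// /= ltn_eqF// mul0r add0r jN//.
  have /lerNnormlW := bnd (S w).1.2 (S w).2.1 (S w).2.2 yr.
  rewrite -(ler_pM2l (expR_gt0 (- (lambda * h * N%:R)))) -/e.
  by lra.
have : (\int[P]_w (r w + c1)%:E <= (pot (init_state R))%:E)%E.
  apply: (le_trans _ main); apply: le_integral => //.
  - exact: (integrableD measurableT ir ic1).
  - apply/integrableP; split; first by apply/measurable_EFinP; exact: measurableT_comp.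
    under eq_integral do rewrite gee0_abs ?lee_fin//.
    exact: le_lt_trans main (ltry _).
  - by move=> w _; rewrite lee_fin.
rewrite (_ : (\int[P]_w (r w + c1)%:E)%E = (\int[P]_w (r w)%:E + c1%:E)%E); last first.
  under eq_integral do rewrite EFinD.
  rewrite integralD// integral_cst// [X in (_ + _ * X)%E](_ : _ = 1%E) ?mule1//.
  exact: probability_setT.
move=> /le_trans /(_ (_ : _ <= (V 0%N 0 + eta * barrier_bound mu sigma a lambda n + C0)%:E)%E).
rewrite lee_fin => /(_ initE).
rewrite -leeBrDr// -EFinB => /le_trans; apply; rewrite lee_fin /c1 -/e.
by lra.
Qed.

End RewardLimit.

Section RewardCvg.
Context (R : realType) (mu sigma a lambda : R).
Hypotheses (sigma_gt0 : 0 < sigma) (a_gt0 : 0 < a) (lambda_gt0 : 0 < lambda).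
Context (n : nat) (n_gt0 : (0 < n)%N).
Context (d : measure_display) (T : measurableType d) (P : probability T R).
Context (nu : nat -> probability R R) (xi : nat -> nat -> T -> R).

Definition mesh (m : nat) : R := 2^-1 ^+ m.

Hypothesis incr : forall m, increments_spec P (mesh m) (nu m) (xi m) (4 ^ m).

Definition grid_state (m : nat) (w : T) : state R :=
  chain (chain_step mu sigma a n (mesh m)) (xi m) (init_state R) (4 ^ m) w.

Definition grid_discount (m : nat) (w : T) : R :=
  discount_factor lambda n (mesh m) (grid_state m w).

Lemma mesh_gt0 m : 0 < mesh m.
Proof. by rewrite exprn_gt0. Qed.

Lemma mesh_horizon m : mesh m * (4 ^ m)%:R = 2 ^+ m.
Proof.
rewrite /mesh natrX -exprMn; congr (_ ^+ _).
by field.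
Qed.

Lemma mesh_lt e : 0 < e -> \forall m \near \oo, mesh m < e.
Proof.
move=> e0; have : mesh m @[m --> \oo] --> (0 : R).
  by apply: cvg_expr; rewrite ger0_norm// invf_lt1// ltr1n.
move=> /cvgrPdist_lt /(_ e e0); apply: filterS => m.
by rewrite sub0r normrN ger0_norm// ltW// mesh_gt0.
Qed.

Lemma measurable_grid_state m : measurable_fun setT (grid_state m).
Proof.
have [_ mxi _] := incr m.
by apply: measurable_chain => //; exact: measurable_chain_step.
Qed.

Lemma reward_eventually_le V C (e : R) :
  level_values mu sigma a lambda n V C -> 0 < e ->
  \forall m \near \oo, (\int[P]_w (grid_discount m w *
    V n (grid_state m w).2.2)%:E <= (V 0%N 0 + e)%:E)%E.
Proof.
move=> HV e0; set bb := barrier_bound mu sigma a lambda n.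
have bb0 : 0 <= bb.
  apply: addr_ge0; first by rewrite (le_trans (ltW a_gt0))// barrier_const_ge.
  by rewrite mulr_ge0// addr_ge0// ltW.
have bb1 : 0 < bb + 1 by exact: ltr_wpDl.
(* One half of [e] is for the initial barrier, the other for the horizon term, which vanishes
   because [mesh m * 4 ^ m = 2 ^ m]. *)
have eta0 : 0 < e / 2 / (bb + 1) by rewrite !divr_gt0.
have [h0 h00 [C0 C00 upper]] :=
  reward_upper sigma_gt0 a_gt0 lambda_gt0 n_gt0 P HV eta0.
have C1 : 0 < C0 + 1 by exact: ltr_wpDl.
near=> m.
have hm : 0 < mesh m < h0 by rewrite mesh_gt0/=; near: m; exact: mesh_lt.
apply: le_trans (upper _ _ _ _ hm (incr m)) _; rewrite lee_fin -addrA lerD2l.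
have b1 : e / 2 / (bb + 1) * bb <= e / 2.
  by rewrite mulrAC ler_pdivrMr// ler_wpM2l ?divr_ge0 ?(ltW e0)// lerDl.
have small : mesh m < e / 2 * lambda / (C0 + 1).
  by near: m; apply: mesh_lt; rewrite !mulr_gt0// invr_gt0.
rewrite -(mulrA lambda) mesh_horizon.
have lm : 0 < lambda * 2 ^+ m by rewrite mulr_gt0// exprn_gt0.
have b2 : expR (- (lambda * 2 ^+ m)) <= (lambda * 2 ^+ m)^-1.
  rewrite expRN lef_pV2 ?posrE ?expR_gt0//.
  by rewrite (le_trans _ (expR_ge1Dx _))// lerDr.
have mE : (2 : R) ^+ m = (mesh m)^-1 by rewrite /mesh exprVn invrK.
have b3 : C0 * expR (- (lambda * 2 ^+ m)) <= e / 2.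
  apply: (le_trans (ler_wpM2l C00 b2)).
  rewrite mE invfM invrK (_ : _ * (_ * _) = C0 * mesh m / lambda); last by ring.
  rewrite ler_pdivrMr//; move: small; rewrite ltr_pdivlMr// => small.
  apply: le_trans (ltW small); rewrite mulrC ler_wpM2l ?(ltW (mesh_gt0 m))//.
  by rewrite lerDl.
by rewrite -/bb; lra.
Unshelve. all: by end_near.
Qed.

Lemma reward_cvg V C : level_values mu sigma a lambda n V C ->
  (\int[P]_w (grid_discount m w * V n (grid_state m w).2.2)%:E)%E @[m --> \oo]
    --> (V 0%N 0)%:E.
Proof.
move=> HV; have HVN := level_valuesN HV.
pose VN k x := - V k x.
pose r V m w := (grid_discount m w * V n (grid_state m w).2.2)%:E.
have ir m : P.-integrable setT (r V m).
  apply: (reward_integrable lambda_gt0 P HV (ltW (mesh_gt0 m))).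
  exact: measurable_grid_state.
have finr m : (\int[P]_w (r V m w))%E \is a fin_num by exact: integrable_fin_num.
rewrite (_ : (fun m => _) = EFin \o (fun m => fine (\int[P]_w (r V m w))%E)); last first.
  by apply/funext => m /=; rewrite fineK.
apply: cvg_EFin; first by near=> m.
apply/cvgrPdist_le => e e0; near=> m.
have h1 : (\int[P]_w (r V m w) <= (V 0%N 0 + e)%:E)%E.
  by near: m; exact: reward_eventually_le HV e0.
have h2 : (\int[P]_w (r VN m w) <= (- V 0%N 0 + e)%:E)%E.
  by near: m; exact: reward_eventually_le HVN e0.
move: h1 h2; rewrite -(fineK (finr m)) lee_fin => h1.
have -> : (\int[P]_w (r VN m w) = - \int[P]_w (r V m w))%E.
  rewrite -integralN; last by rewrite fin_num_adde_defl// fin_numN; exact: integrable_neg_fin_num (ir m).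
  by apply: eq_integral => w _; rewrite /r mulrN EFinN.
rewrite -(fineK (finr m)) -EFinN lee_fin => h2 /=.
by rewrite ler_distlC; apply/andP; split; lra.
Unshelve. all: by end_near.
Qed.

End RewardCvg.

(** * Drawdown times of continuous paths *)

Section SequenceDrops.
Context (R : realType).
Implicit Types (a : R) (y : nat -> R).

(* k successive drops of size at least a between consecutive grid times, the
   last one ending at or before j. *)
Fixpoint drops a y (k j : nat) : Prop :=
  if k is k'.+1 then
    exists i j', [/\ (i < j')%N, (j' <= j)%N, drops a y k' i & a <= y i - y j']
  else True.

Lemma dropsW a y k i j : (i <= j)%N -> drops a y k i -> drops a y k j.
Proof.
case: k => // k ij [i' [j' [lt_ij le_j di ay]]].
by exists i', j'; split => //; exact: leq_trans ij.
Qed.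

Lemma drops_level a a' y k j : a' <= a -> drops a y k j -> drops a' y k j.
Proof.
move=> aa; elim: k j => //= k IH j [i [j' [lt_ij le_j di ay]]].
by exists i, j'; split => //; [exact: IH|exact: le_trans ay].
Qed.

(** Here [z] samples the path of [y] on a grid twice as fine; this makes the discount factor
    monotone in the grid. *)
Lemma drops_refine a y z k j : (forall i, z (2 * i)%N = y i) ->
  drops a y k j -> drops a z k (2 * j)%N.
Proof.
move=> zy; elim: k j => //= k IH j [i [j' [lt_ij le_j di ay]]].
exists (2 * i)%N, (2 * j')%N; rewrite !zy ltn_pmul2l// leq_pmul2l//.
by split => //; exact: IH.
Qed.

Lemma dropsS a y k j : drops a y k.+1 j -> drops a y k j.
Proof.
move=> [i [j' [lt_ij le_j di _]]]; apply: dropsW di.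
exact: leq_trans (ltnW lt_ij) le_j.
Qed.

Lemma drops_le a y k k' j : (k <= k')%N -> drops a y k' j -> drops a y k j.
Proof.
move=> kk; rewrite -(subnK kk); elim: (k' - k)%N => // i IH /dropsS.
exact: IH.
Qed.

Context (mu sigma h : R) (n : nat) (a : R) (a_gt0 : 0 < a).

(** Positions are relative to [y 0]: the chain starts at 0, a Brownian path only almost surely. *)
Definition tracks y (N : nat) (s : state R) : Prop :=
  (s.1.2 <= n)%N /\
  if (s.1.2 < n)%N then
    [/\ s.1.1 = N, s.2.2 = y N - y 0%N, drops a y s.1.2 N,
        ~ drops a y s.1.2.+1 N &
        (forall i, (i <= N)%N -> drops a y s.1.2 i -> y i - y 0%N <= s.2.1) /\
        exists i, [/\ (i <= N)%N, drops a y s.1.2 i & s.2.1 = y i - y 0%N]]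
  else [/\ (s.1.1 <= N)%N, drops a y n s.1.1,
        forall i, (i < s.1.1)%N -> ~ drops a y n i & s.2.2 = y s.1.1 - y 0%N].

(* The greedy count of drops is maximal: the maximum since the last reset ranges
   exactly over the times at which k drops have already been completed. *)
Lemma chain_tracks y (xi : nat -> R) : (0 < n)%N ->
  (forall i, y i.+1 = y i + (mu * h + sigma * xi i)) ->
  forall N (d : measure_display) (T : measurableType d) (zeta : nat -> T -> R) (w : T),
  (forall i, zeta i w = xi i) ->
  tracks y N (chain (chain_step mu sigma a n h) zeta (init_state R) N w).
Proof.
move=> n0 yS N d T zeta w zE; elim: N => [|N].
  split => //=; rewrite n0 subrr; split => //.
    by move=> [i [j' [lt_ij le_j _ _]]]; have := leq_trans lt_ij le_j; rewrite ltn0.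
  split => [i|]; first by rewrite leqn0 => /eqP ->; rewrite subrr.
  by exists 0%N; rewrite subrr.
rewrite /=; case: (chain _ _ _ _ _) => [[j k] [M X]].
rewrite zE /tracks /=; case=> kn; case: ifP => [ltkn|gekn]; last first.
  move=> [jN dj nd XE]; rewrite /chain_step /active /= gekn /= gekn; split => //.
  by split => //; exact: leqW.
move=> [-> XE dk ndk [Mub [i0 [i0N di0 ME]]]].
(* Otherwise the fall from the maximum, reached at [i0], to the position at [N] would complete one
   more drop. *)
have act : active a n ((N, k), (M, X)).
  rewrite /active /= ltkn /= subr_ge0 XE Mub//= ltNge; apply/negP => aMX.
  apply: ndk; exists i0, N; split => //.
    rewrite ltn_neqAle i0N andbT; apply/eqP => i0E; move: aMX.
    by rewrite ME i0E subrr leNgt a_gt0.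
  by move: aMX; rewrite ME; lra.
rewrite chain_stepE//= /drawdown_step.
have -> : X + (mu * h + sigma * xi N) = y N.+1 - y 0%N by rewrite yS XE; ring.
have [reset|noreset] := leP a; rewrite /=.
  have dk1 : drops a y k.+1 N.+1.
    exists i0, N.+1; split => //.
    by move: reset; rewrite ME; lra.
  split => //; case: ifP => ltk1n; last first.
    have kE : k.+1 = n by apply/eqP; rewrite eqn_leq ltkn leqNgt ltk1n.
    rewrite -kE; split => // i; rewrite ltnS => iN di; apply: ndk.
    exact: (@dropsW a y k.+1 _ _ iN di).
  split => //.
    by move=> [i [j' [lt_ij le_j di _]]]; apply: ndk; apply: (@dropsW a y k.+1 _ _ _ di);
       rewrite -ltnS; exact: leq_trans le_j.
  split; last by exists N.+1.
  move=> i; rewrite leq_eqVlt => /orP[/eqP -> //|]; rewrite ltnS => iN di.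
  by case: ndk; exact: (@dropsW a y k.+1 _ _ iN di).
rewrite ltkn; split => //; split => //.
- exact: dropsW dk.
- move=> [i [j' [lt_ij le_j di aij]]]; move: le_j; rewrite leq_eqVlt ltnS.
  case/orP => [/eqP j'E|j'N]; last by apply: ndk; exists i, j'.
  have iN : (i <= N)%N by rewrite -ltnS -j'E.
  have := Mub i iN di; move: noreset aij; rewrite j'E; lra.
- split.
    move=> i; rewrite leq_eqVlt => /orP[/eqP -> _|]; first by rewrite le_max lexx orbT.
    by rewrite ltnS => iN di; rewrite le_max Mub.
  have [MX|XM] := leP M (y N.+1 - y 0%N).
    exists N.+1; split => //.
    + exact: dropsW dk.
  by exists i0; split => //; exact: leqW.
Qed.

End SequenceDrops.

Section DrawdownTimes.
Context (R : realType).
Implicit Types (a h t u : R) (x : R -> R).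

Lemma drawdown_time_ge0 a x n : (0 <= drawdown_time a x n)%E.
Proof.
elim: n => //= n IH; apply: le_ereal_inf_tmp => _ [t [lt_t _] <-].
exact: le_trans IH (ltW lt_t).
Qed.

Lemma drawdown_time_le a h x n j : 0 < h ->
  drops a (fun i => x (h * i%:R)) n j -> (drawdown_time a x n <= (h * j%:R)%:E)%E.
Proof.
move=> h0; elim: n j => [|n IH] j /=; first by rewrite lee_fin mulr_ge0// ltW.
move=> [i [j' [lt_ij le_j /IH tau_i ai]]].
apply: (@le_trans _ _ (h * j'%:R)%:E); last by rewrite lee_fin ler_pM2l// ler_nat.
apply: ereal_inf_lbound; exists (h * j'%:R) => //; split.
  by apply: (le_lt_trans tau_i); rewrite lte_fin ltr_pM2l// ltr_nat.
apply: (@le_trans _ _ ((x (h * i%:R))%:E - (x (h * j'%:R))%:E)%E).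
  by rewrite -EFinB lee_fin.
apply: leeD2r; apply: ereal_sup_ubound; exists (h * i%:R) => //; split => //.
by rewrite ler_pM2l// ler_nat ltnW.
Qed.

Definition grid_index (m : nat) t : nat := Num.truncn (t / mesh R m).

Lemma grid_index_le m t u : t <= u -> (grid_index m t <= grid_index m u)%N.
Proof.
move=> tu; apply: le_truncn; rewrite ler_pM2r//.
by rewrite invr_gt0 mesh_gt0.
Qed.

Lemma grid_point_bounds m t : 0 <= t ->
  mesh R m * (grid_index m t)%:R <= t < mesh R m * (grid_index m t)%:R + mesh R m.
Proof.
move=> t0; have m0 := mesh_gt0 R m.
have : 0 <= t / mesh R m by rewrite divr_ge0// ltW.
move=> /truncn_itv /andP[h1 h2].
rewrite mulrC -ler_pdivlMr// h1 /=.
by rewrite -[X in _ + X]mul1r -mulrDl -ltr_pdivrMr// -natr1 in h2 *.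
Qed.

Definition continuous_path x := forall u (e : R), 0 <= u -> 0 < e ->
  exists2 del : R, 0 < del & forall v, 0 <= v -> `|v - u| < del -> `|x v - x u| < e.

Lemma grid_point_cvg x u (e : R) : continuous_path x -> 0 <= u -> 0 < e ->
  \forall m \near \oo, `|x (mesh R m * (grid_index m u)%:R) - x u| < e.
Proof.
move=> cx u0 e0; have [del del0 H] := cx u e u0 e0.
near=> m; have /andP[h1 h2] := grid_point_bounds m u0.
apply: H; first by rewrite mulr_ge0// ltW// mesh_gt0.
have : mesh R m < del by near: m; exact: mesh_lt.
by rewrite distrC ger0_norm ?subr_ge0//; lra.
Unshelve. all: by end_near.
Qed.

Lemma drops_eventually a a' x k t : continuous_path x -> 0 < a' -> a' < a ->
  (drawdown_time a x k < t%:E)%E ->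
  \forall m \near \oo, drops a' (fun i => x (mesh R m * i%:R)) k (grid_index m t).
Proof.
move=> cx a0 aa; elim: k t => [|k IH] t /=; first by move=> _; near=> m.
move=> /ereal_inf_lt [_ [t' [tau_t' +] <-]]; rewrite lte_fin => drop tt.
(* Four errors of size [e] occur: at the supremum, from [u] to [u'], and at two grid points. *)
pose e := (a - a') / 5.
have e0 : 0 < e by rewrite divr_gt0// subr_gt0.
have eE : a - a' = 5 * e by rewrite /e; field.
have t'0 : 0 <= t'.
  by rewrite -lee_fin (le_trans (drawdown_time_ge0 a x k))// ltW.
have : ((a - e + x t')%:E < running_sup x (drawdown_time a x k) t')%E.
  have {drop} : (a%:E <= running_sup x (drawdown_time a x k) t' - (x t')%:E)%E by [].
  rewrite leeBrDr// -EFinD; apply: lt_le_trans.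
  by rewrite lte_fin ltrD2r; lra.
move=> /ereal_sup_gt [_ [u [tau_u ut'] <-]]; rewrite lte_fin => xu.
have u0 : 0 <= u by rewrite -lee_fin (le_trans (drawdown_time_ge0 a x k)).
have {}ut' : u < t'.
  rewrite lt_neqAle ut' andbT; apply/eqP => uE; move: xu; rewrite uE.
  by move: e0 eE a0 => ? ? ?; lra.
have [del del0 near_u] := cx u e u0 e0.
(* The near-maximum [u] may be the previous drawdown time itself; [u'] is strictly later, as the
   induction hypothesis demands. *)
pose u' := u + Num.min (t' - u) del / 2.
have mn0 : 0 < Num.min (t' - u) del by rewrite lt_min subr_gt0 ut'.
have uu' : u < u' by rewrite /u'; lra.
have u't' : u' < t'.
  have : Num.min (t' - u) del <= t' - u by rewrite ge_min lexx.
  by rewrite /u'; lra.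
have u'del : u' - u < del.
  have : Num.min (t' - u) del <= del by rewrite ge_min lexx orbT.
  by rewrite /u'; lra.
have u'0 : 0 <= u' by lra.
have xu' : `|x u' - x u| < e.
  by apply: near_u => //; rewrite ger0_norm; lra.
have tau_u' : (drawdown_time a x k < u'%:E)%E.
  by apply: (le_lt_trans tau_u); rewrite lte_fin.
near=> m.
have d1 : drops a' (fun i => x (mesh R m * i%:R)) k (grid_index m u').
  by near: m; exact: IH.
have c1 : `|x (mesh R m * (grid_index m u')%:R) - x u'| < e.
  by near: m; exact: grid_point_cvg.
have c2 : `|x (mesh R m * (grid_index m t')%:R) - x t'| < e.
  by near: m; exact: grid_point_cvg.
have big : a' <= x (mesh R m * (grid_index m u')%:R) -
    x (mesh R m * (grid_index m t')%:R).
  move: c1 c2 xu'; rewrite !ltr_norml => /andP[? ?] /andP[? ?] /andP[? ?].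
  by move: xu eE => ? ?; lra.
exists (grid_index m u'), (grid_index m t'); split => //.
  rewrite ltn_neqAle grid_index_le ?(ltW u't')// andbT; apply/eqP => E.
  by move: big; rewrite E subrr leNgt a0.
exact: grid_index_le (ltW tt).
Unshelve. all: by end_near.
Qed.

End DrawdownTimes.

(** * Ramp rewards *)

Section ErlangTails.
Context (R : realType).
Implicit Types y u v s : R.

Definition poisson_weight (j : nat) y : R := expR (- y) * y ^+ j / j`!%:R.

Definition erlang_tail (i : nat) y : R := \sum_(j < i) poisson_weight j y.

(* The integral of [erlang_tail i] over [y, +oo), for y >= 0. *)
Definition erlang_excess (i : nat) y : R := \sum_(l < i) erlang_tail l.+1 y.

Lemma erlang_tailE i y :
  erlang_tail i y = expR (- y) * \sum_(0 <= m < i) y ^+ m / m`!%:R.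
Proof.
rewrite /erlang_tail big_mkord mulr_sumr.
by apply: eq_bigr => m _; rewrite /poisson_weight mulrA.
Qed.

Lemma poisson_weight_ge0 j y : 0 <= y -> 0 <= poisson_weight j y.
Proof. by move=> y0; rewrite divr_ge0// mulr_ge0 ?expR_ge0 ?exprn_ge0. Qed.

Lemma erlang_tail0 i : (0 < i)%N -> erlang_tail i 0 = 1.
Proof.
case: i => // i _; rewrite /erlang_tail big_ord_recl big1 => [|j _].
  by rewrite /poisson_weight oppr0 expR0 expr0 !mul1r fact0 invr1 addr0.
by rewrite /poisson_weight expr0n /= mulr0 mul0r.
Qed.

Lemma erlang_tail_ge0 i y : 0 <= y -> 0 <= erlang_tail i y.
Proof. by move=> y0; apply: sumr_ge0 => j _; exact: poisson_weight_ge0. Qed.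

Lemma is_derive_poisson_weight0 y :
  is_derive y 1 (poisson_weight 0) (- poisson_weight 0 y).
Proof.
rewrite (_ : poisson_weight 0 = fun y => expR (- y)); last first.
  by apply/funext => z; rewrite /poisson_weight expr0 fact0 invr1 !mulr1.
by apply: is_derive_eq; rewrite mulrN1.
Qed.

Lemma is_derive_poisson_weightS j y :
  is_derive y 1 (poisson_weight j.+1) (poisson_weight j y - poisson_weight j.+1 y).
Proof.
have j0 : (j`!%:R : R) != 0 by rewrite pnatr_eq0 -lt0n fact_gt0.
have j1 : 1 + j%:R != 0 :> R by rewrite nat1r pnatr_eq0.
have d1 : is_derive y 1 (fun z : R => expR (- z)) (- expR (- y)).
  by apply: is_derive_eq; rewrite mulrN1.
have d2 : is_derive y 1 (fun z : R => z ^+ j.+1) (j.+1%:R * y ^+ j).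
  split; first exact: exprn_derivable.
  by rewrite exp_derive /GRing.scale /= mulr1.
rewrite [X in is_derive _ _ X _](_ : _ = ((j.+1)`!%:R^-1 : R) *:
    ((fun z : R => expR (- z)) * (fun z : R => z ^+ j.+1))); last first.
  by apply/funext => z; rewrite /poisson_weight /GRing.scale /= mulrC.
apply: is_derive_eq; rewrite /poisson_weight /GRing.scale /= factS natrM exprS.
by rewrite -nat1r; field; rewrite j0.
Qed.

(** The derivatives of the Poisson weights telescope. *)
Lemma is_derive_erlang_tail i y :
  is_derive y 1 (erlang_tail i.+1) (- poisson_weight i y).
Proof.
have tailS k : erlang_tail k.+1 = erlang_tail k + poisson_weight k.
  by apply/funext => z; rewrite /erlang_tail big_ord_recr.
elim: i => [|i IH].
  rewrite (_ : erlang_tail 1 = poisson_weight 0); first exact: is_derive_poisson_weight0.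
  by apply/funext => z; rewrite /erlang_tail big_ord1.
rewrite tailS; have dS := is_derive_poisson_weightS i y.
by apply: is_derive_eq; ring.
Qed.

Lemma is_derive_erlang_excess i y :
  is_derive y 1 (erlang_excess i) (- erlang_tail i y).
Proof.
elim: i => [|i IH].
  rewrite (_ : erlang_excess 0 = cst 0); last first.
    by apply/funext => z; rewrite /erlang_excess big_ord0.
  by rewrite /erlang_tail big_ord0 oppr0; exact: is_derive_cst.
rewrite (_ : erlang_excess i.+1 = erlang_excess i + erlang_tail i.+1); last first.
  by apply/funext => z; rewrite /erlang_excess big_ord_recr.
have dT := is_derive_erlang_tail i y.
by apply: is_derive_eq; rewrite /erlang_tail [in RHS]big_ord_recr /= opprD.
Qed.

Let mvt (f df : R -> R) u v : u <= v -> (forall z : R, is_derive z (1 : R) f (df z)) ->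
  exists2 z, u <= z <= v & f v - f u = df z * (v - u).
Proof.
rewrite le_eqVlt => /orP[/eqP ->|uv] fdf.
  by exists v; rewrite ?lexx// !subrr mulr0.
have cf : {within `[u, v], continuous f}.
  apply: derivable_within_continuous => z _; exact: ex_derive.
have [z + fE] := MVT uv (fun z _ => fdf z) cf.
by rewrite in_itv /= => /andP[/ltW uz /ltW zv]; exists z => //; rewrite uz.
Qed.

Lemma erlang_tail_le1 i y : 0 <= y -> erlang_tail i y <= 1.
Proof.
case: i => [|i] y0; first by rewrite /erlang_tail big_ord0.
have [z /andP[z0 _]] := mvt y0 (is_derive_erlang_tail i).
rewrite erlang_tail0// subr0 mulNr => E; rewrite -subr_le0 E oppr_le0.
by rewrite mulr_ge0// poisson_weight_ge0.
Qed.

Lemma poisson_weight_le1 j y : 0 <= y -> poisson_weight j y <= 1.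
Proof.
move=> y0; apply: le_trans (erlang_tail_le1 j.+1 y0).
rewrite /erlang_tail big_ord_recr /= lerDr.
exact: (erlang_tail_ge0 j y0).
Qed.

Lemma erlang_tail_lipschitz i u v : 0 <= u <= v ->
  `|erlang_tail i v - erlang_tail i u| <= v - u.
Proof.
move=> /andP[u0 uv]; case: i => [|i].
  by rewrite /erlang_tail !big_ord0 subrr normr0 subr_ge0.
have [z /andP[uz zv] ->] := mvt uv (is_derive_erlang_tail i).
have z0 := le_trans u0 uz.
rewrite normrM normrN (ger0_norm (poisson_weight_ge0 _ z0)) ger0_norm ?subr_ge0//.
by rewrite ler_piMl ?subr_ge0// poisson_weight_le1.
Qed.

Lemma erlang_excess_taylor i u v : 0 <= u <= v ->
  `|erlang_excess i u - erlang_excess i v - (v - u) * erlang_tail i v|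
  <= (v - u) ^+ 2.
Proof.
move=> /andP[u0 uv]; have [z /andP[uz zv] E] := mvt uv (is_derive_erlang_excess i).
have -> : erlang_excess i u - erlang_excess i v - (v - u) * erlang_tail i v =
    (v - u) * (erlang_tail i z - erlang_tail i v).
  by rewrite -[erlang_excess i u - _]opprB E; ring.
rewrite normrM ger0_norm ?subr_ge0// expr2 ler_wpM2l ?subr_ge0//.
rewrite distrC (le_trans (erlang_tail_lipschitz i (_ : 0 <= z <= v)))//.
  by rewrite zv (le_trans u0 uz).
by rewrite lerB.
Qed.

Lemma erlang_excess_lipschitz i u v : 0 <= u <= v ->
  `|erlang_excess i v - erlang_excess i u| <= v - u.
Proof.
move=> /andP[u0 uv]; have [z /andP[uz zv] ->] := mvt uv (is_derive_erlang_excess i).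
have z0 := le_trans u0 uz.
rewrite normrM normrN (ger0_norm (erlang_tail_ge0 _ z0)) ger0_norm ?subr_ge0//.
by rewrite ler_piMl ?subr_ge0// erlang_tail_le1.
Qed.

End ErlangTails.

Section StopLoss.
Context (R : realType).
Implicit Types y s : R.

(* The extensions of [erlang_tail i] and [erlang_excess i] to the whole line:
   tail and stop-loss transform of a sum of i independent standard exponential
   variables. *)
Definition stop_loss (i : nat) y : R :=
  Num.max (- y) 0 + erlang_excess i (Num.max y 0).

(** The derivative of [stop_loss i.+1] is minus this same tail; equating the two expressions of the
    tail gives the level equation. *)
Lemma stop_lossS i y :
  stop_loss i.+1 y - stop_loss i y = erlang_tail i.+1 (Num.max y 0).
Proof. by rewrite /stop_loss /erlang_excess big_ord_recr /=; ring. Qed.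

(** The derivative is minus the tail, which for at least one phase is Lipschitz across 0, because it
    is 1 at and below 0. Without any phase the stop-loss has a kink at 0, hence the index [i.+1]. *)
Lemma stop_loss_taylor i y s : 0 <= s ->
  `|stop_loss i.+1 (y - s) - stop_loss i.+1 y -
    s * erlang_tail i.+1 (Num.max y 0)| <= s ^+ 2.
Proof.
move=> s0; rewrite /stop_loss.
have pos (z : R) : 0 <= z -> Num.max z 0 = z by move=> z0; exact: max_l.
have neg (z : R) : z <= 0 -> Num.max z 0 = 0 by move=> z0; exact: max_r.
have [sy|ys] := leP s y.
  have y0 := le_trans s0 sy.
  rewrite (pos y)// (pos (y - s)) ?subr_ge0// (neg (- y)) ?oppr_le0//.
  rewrite (neg (- (y - s))) ?oppr_le0 ?subr_ge0// !add0r.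
  have := @erlang_excess_taylor R i.+1 (y - s) y.
  rewrite subr_ge0 sy lerBlDr lerDl s0 => /(_ isT).
  by rewrite (_ : y - (y - s) = s)//; ring.
rewrite (neg (y - s)) ?subr_le0 ?(ltW ys)//.
rewrite (pos (- (y - s))) ?opprB ?subr_ge0 ?(ltW ys)//.
have [y0|y0] := leP y 0.
  rewrite (pos (- y)) ?oppr_ge0// erlang_tail0//.
  rewrite (_ : s - y + _ - _ - _ = 0) ?normr0 ?sqr_ge0//; ring.
rewrite (neg (- y)) ?oppr_le0 ?(ltW y0)// add0r.
have := @erlang_excess_taylor R i.+1 0 y; rewrite lexx (ltW y0) subr0 => /(_ isT).
have := @erlang_tail_lipschitz R i.+1 0 y; rewrite lexx (ltW y0) subr0 => /(_ isT).
rewrite erlang_tail0//; set q := erlang_tail _ y; set E0 := erlang_excess _ 0.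
set E := erlang_excess _ y => hq hE.
(* Here 0 lies between [y - s] and [y]: above 0 remains the Taylor remainder of [erlang_excess] on
   [[0, y]], and below, over a length [s - y], the tail is 1. *)
have -> : s - y + E0 - E - s * q = (E0 - E - y * q) + (s - y) * (1 - q) by ring.
apply: (le_trans (ler_normD _ _)).
rewrite normrM (gtr0_norm (_ : 0 < s - y)) ?subr_gt0// distrC in hq *.
have : (s - y) * `|1 - q| <= (s - y) * y.
  by rewrite ler_wpM2l ?subr_ge0 ?(ltW ys)// distrC.
have : 0 <= y * (s - y) by rewrite mulr_ge0 ?subr_ge0 ?ltW.
rewrite !expr2 in hE *; nra.
Qed.

Lemma stop_loss_lipschitz i y s : 0 <= s ->
  `|stop_loss i (y + s) - stop_loss i y| <= 2 * s.
Proof.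
move=> s0; rewrite /stop_loss.
have h1 : `|Num.max (- (y + s)) 0 - Num.max (- y) 0| <= s.
  have [|] := leP (- (y + s)) 0; have [|] := leP (- y) 0 => ? ?;
    by rewrite ler_norml; apply/andP; split; lra.
have : 0 <= Num.max y 0 <= Num.max (y + s) 0.
  rewrite le_max lexx orbT /= ge_max !le_max lexx orbT andbT lerDl s0 //.
move=> /(erlang_excess_lipschitz i).
have h2 : Num.max (y + s) 0 - Num.max y 0 <= s.
  by have [|] := leP (y + s) 0; have [|] := leP y 0 => ? ?; lra.
move=> /le_trans /(_ h2) h3.
rewrite [X in `|X|](_ : _ = (Num.max (- (y + s)) 0 - Num.max (- y) 0) +
  (erlang_excess i (Num.max (y + s) 0) - erlang_excess i (Num.max y 0))); last by ring.
by rewrite (le_trans (ler_normD _ _))// mulr_natl mulr2n lerD.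
Qed.

End StopLoss.

(** * Solutions of the level equation *)

Section LevelFamilies.
Context (R : realType) (mu sigma a lambda : R).
Hypotheses (sigma_gt0 : 0 < sigma) (a_gt0 : 0 < a) (lambda_gt0 : 0 < lambda).
Local Notation b := (b_const mu sigma a lambda).
Local Notation c := (c_const mu sigma a lambda).
Implicit Types x y r m : R.

Let b0 : 0 < b. Proof. exact: b_const_gt0. Qed.
Let c0 : 0 < c. Proof. exact: c_const_gt0. Qed.
Let cb0 : 0 < c / b. Proof. exact: divr_gt0. Qed.

Let ratio_pow_le n i : (i <= n)%N -> (c / b) ^+ i <= (1 + c / b) ^+ n.
Proof.
move=> iN; have q1 : 1 <= 1 + c / b by rewrite lerDl ltW.
apply: (@le_trans _ _ ((1 + c / b) ^+ i)).
  by apply: lerXn2r; rewrite ?nnegrE ?lerDr ?(ltW cb0)// (le_trans _ q1).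
exact: ler_weXn2l.
Qed.

(** Terminal reward 1: the Taylor condition reduces to [b * V k = c * V k.+1], and the initial value
    is the limiting mean of the discount factor alone. *)
Lemma level_values_const n : exists C,
  level_values mu sigma a lambda n (fun k _ => (c / b) ^+ (n - k)) C.
Proof.
exists ((1 + c / b) ^+ n).
have Q0 : 0 <= (1 + c / b) ^+ n by rewrite exprn_ge0// addr_ge0// ltW.
split => // k m.
- by move=> kn; rewrite ger0_norm ?exprn_ge0 ?(ltW cb0)// ratio_pow_le// leq_subr.
- move=> r kn r0; rewrite (_ : _ - _ = 0) ?normr0 ?mulr_ge0 ?sqr_ge0//.
  rewrite -{3}(subnSK kn) exprS; field; exact: lt0r_neq0.
- by move=> r kn r0; rewrite subrr normr0 mulr_ge0.
Qed.

(* The terminal values V n m form the ramp from 0 at m = x to 1 at m = x + e. *)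
Definition ramp_values x e (n k : nat) m : R :=
  (c / b) ^+ (n - k) *
  ((stop_loss (n - k) (b * (x - m + (n - k)%:R * a)) -
    stop_loss (n - k) (b * (x + e - m + (n - k)%:R * a))) / (b * e)).

Lemma level_values_ramp x e n : 0 < e -> exists C,
  level_values mu sigma a lambda n (ramp_values x e n) C.
Proof.
move=> e0; set Q := (1 + c / b) ^+ n.
have Q0 : 0 <= Q by rewrite exprn_ge0// addr_ge0// ltW.
have be0 : 0 < b * e by rewrite mulr_gt0.
have pQ i : (i <= n)%N -> 0 <= (c / b) ^+ i <= Q.
  by move=> iN; rewrite exprn_ge0 ?(ltW cb0)// ratio_pow_le.
have T1 : 0 <= Q * 2 by rewrite mulr_ge0.
have T2 : 0 <= Q * (2 * b ^+ 2 / (b * e)).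
  by rewrite mulr_ge0// divr_ge0 ?(ltW be0)// mulr_ge0// sqr_ge0.
have T3 : 0 <= Q * (4 * b / (b * e)).
  by rewrite mulr_ge0// divr_ge0 ?(ltW be0)// mulr_ge0// ltW.
(* The summands serve the bound, the Taylor and the Lipschitz condition in turn. The last two blow
   up as [e] tends to 0, so the grid is refined first, for fixed [e]. *)
exists (Q * 2 + Q * (2 * b ^+ 2 / (b * e)) + Q * (4 * b / (b * e))); split.
- by rewrite !addr_ge0.
- move=> k m kn; have /andP[p0 pq] := pQ _ (leq_subr k n).
  apply: (@le_trans _ _ (Q * 2)); last by rewrite -addrA lerDl addr_ge0.
  rewrite /ramp_values normrM (ger0_norm p0) ler_pM//.
  rewrite normrM [`|_^-1|]gtr0_norm ?invr_gt0// ler_pdivrMr//.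
  rewrite distrC; have := @stop_loss_lipschitz R (n - k)
    (b * (x - m + (n - k)%:R * a)) (b * e) (ltW be0).
  by rewrite (_ : b * _ + b * e = b * (x + e - m + (n - k)%:R * a))//; ring.
- move=> k m r kn r0; have /andP[p0 pq] := pQ _ (leq_subr k n).
  have [i iE] : exists i, (n - k)%N = i.+1 by exists (n - k.+1)%N; rewrite subnSK.
  have iE' : (n - k.+1)%N = i by move: iE; rewrite subnS => ->.
  rewrite /ramp_values iE iE' in p0 pq *.
  set y1 := b * (x - m + i.+1%:R * a); set y2 := b * (x + e - m + i.+1%:R * a).
  have br0 : 0 <= b * r by rewrite mulr_ge0// ltW.
  have t1 := stop_loss_taylor i y1 br0; have t2 := stop_loss_taylor i y2 br0.
  rewrite (_ : b * (x - (m + r) + i.+1%:R * a) = y1 - b * r); last by rewrite /y1; ring.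
  rewrite (_ : b * (x + e - (m + r) + i.+1%:R * a) = y2 - b * r); last by rewrite /y2; ring.
  (* Passing from [k] at level [m] to [k.+1] at level [m - a] keeps the argument of the stop-loss
     transform. *)
  rewrite (_ : b * (x - (m - a) + i%:R * a) = y1); last by rewrite /y1 -natr1; ring.
  rewrite (_ : b * (x + e - (m - a) + i%:R * a) = y2); last by rewrite /y2 -natr1; ring.
  rewrite -!stop_lossS in t1 t2.
  rewrite [X in `|X|](_ : _ = (c / b) ^+ i.+1 *
     (((stop_loss i.+1 (y1 - b * r) - stop_loss i.+1 y1 -
        b * r * (stop_loss i.+1 y1 - stop_loss i y1)) -
       (stop_loss i.+1 (y2 - b * r) - stop_loss i.+1 y2 -
        b * r * (stop_loss i.+1 y2 - stop_loss i y2))) / (b * e))); last first.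
    rewrite exprS; field; rewrite !lt0r_neq0//.
  rewrite normrM (ger0_norm p0).
  apply: (@le_trans _ _ (Q * (2 * b ^+ 2 / (b * e)) * r ^+ 2)); last first.
    by rewrite ler_wpM2r ?sqr_ge0// -addrA addrCA lerDl addr_ge0.
  rewrite -[leRHS]mulrA ler_pM// normrM [`|_^-1|]gtr0_norm ?invr_gt0//.
  rewrite [leRHS]mulrAC ler_pM2r ?invr_gt0// (le_trans (ler_normB _ _))//.
  rewrite (le_trans (lerD t1 t2))//.
  by rewrite le_eqVlt; apply/orP; left; apply/eqP; ring.
- move=> k m r kn r0; have /andP[p0 pq] := pQ _ (leq_subr k n).
  rewrite /ramp_values -mulrBr -mulrBl.
  set y1 := b * (x - m + _); set y2 := b * (x + e - m + _).
  have br0 : 0 <= b * r by rewrite mulr_ge0// ltW.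
  have t1 := stop_loss_lipschitz (n - k) y1 br0.
  have t2 := stop_loss_lipschitz (n - k) y2 br0.
  rewrite (_ : b * (x - (m - r) + _) = y1 + b * r); last by rewrite /y1; ring.
  rewrite (_ : b * (x + e - (m - r) + _) = y2 + b * r); last by rewrite /y2; ring.
  rewrite normrM (ger0_norm p0).
  apply: (@le_trans _ _ (Q * (4 * b / (b * e)) * r)); last first.
    by rewrite ler_wpM2r// lerDr addr_ge0.
  rewrite -[leRHS]mulrA ler_pM// normrM [`|_^-1|]gtr0_norm ?invr_gt0//.
  rewrite [leRHS]mulrAC ler_pM2r ?invr_gt0//.
  rewrite [X in `|X|](_ : _ = (stop_loss (n - k) (y1 + b * r) - stop_loss (n - k) y1) -
     (stop_loss (n - k) (y2 + b * r) - stop_loss (n - k) y2)); last by ring.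
  rewrite (le_trans (ler_normB _ _))// (le_trans (lerD t1 t2))//.
  by rewrite le_eqVlt; apply/orP; left; apply/eqP; ring.
Qed.

Lemma ramp_terminalE x e n m : ramp_values x e n n m =
  (Num.max (b * (m - x)) 0 - Num.max (b * (m - x) - b * e) 0) / (b * e).
Proof.
rewrite /ramp_values subnn expr0 mul1r !mul0r !addr0 /stop_loss.
rewrite /erlang_excess !big_ord0 !addr0.
by congr ((Num.max _ _ - Num.max _ _) / _); ring.
Qed.

Lemma ramp_terminal_bounds x e n m : 0 < e -> 0 <= ramp_values x e n n m <= 1.
Proof.
move=> e0; rewrite ramp_terminalE.
have be0 : 0 < b * e by rewrite mulr_gt0.
rewrite ler_pdivlMr// mul0r ler_pdivrMr// mul1r; set u := b * (m - x).
by have [?|?] := leP u 0; have [?|?] := leP (u - b * e) 0; apply/andP; split; lra.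
Qed.

Lemma ramp_terminal0 x e n m : 0 < e -> m <= x -> ramp_values x e n n m = 0.
Proof.
move=> e0 mx; rewrite ramp_terminalE.
have be0 : 0 < b * e by rewrite mulr_gt0.
have bmx : b * (m - x) <= 0 by rewrite pmulr_rle0// subr_le0.
by rewrite !max_r ?subrr ?mul0r//; lra.
Qed.

Lemma ramp_terminal1 x e n m : 0 < e -> x + e <= m -> ramp_values x e n n m = 1.
Proof.
move=> e0 mx; rewrite ramp_terminalE.
have be0 : 0 < b * e by rewrite mulr_gt0.
have bmx : b * e <= b * (m - x) by rewrite ler_pM2l//; lra.
rewrite !max_l; [|lra|lra].
by rewrite subKr divff// gt_eqF.
Qed.

(** A difference quotient of the stop-loss transform over a step [b * e] approaches the tail, with
    an error of order [e] from [stop_loss_taylor] and from the Lipschitz bound of the tail. *)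
Lemma ramp_initial x e n : 0 < x -> 0 < e -> (0 < n)%N ->
  `|ramp_values x e n 0 0 - (c / b) ^+ n * erlang_tail n (b * (x + n%:R * a))|
  <= (c / b) ^+ n * (2 * b) * e.
Proof.
move=> x0 e0; case: n => // n _; have be0 : 0 < b * e by rewrite mulr_gt0.
rewrite /ramp_values subn0 !subr0.
set y := b * (x + n.+1%:R * a).
have y0 : 0 <= y by rewrite mulr_ge0 ?(ltW b0)// addr_ge0 ?(ltW x0)// mulr_ge0// ltW.
rewrite (_ : b * (x + e + n.+1%:R * a) = y + b * e); last by rewrite /y; ring.
have t1 := stop_loss_taylor n (y + b * e) (ltW be0).
rewrite addrK max_l in t1; last by rewrite addr_ge0// ltW.
have := @erlang_tail_lipschitz R n.+1 y (y + b * e).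
rewrite y0 lerDl (ltW be0) => /(_ isT); rewrite [y + b * e - y]addrC addKr => t2.
rewrite -mulrBr normrM ger0_norm ?exprn_ge0 ?(ltW cb0)// -mulrA.
rewrite ler_wpM2l ?exprn_ge0 ?(ltW cb0)//.
set A := stop_loss _ y - stop_loss _ _; set q := erlang_tail _ y.
rewrite (_ : A / (b * e) - q = (A - b * e * q) / (b * e)); last first.
  by field; rewrite !gt_eqF.
rewrite normrM [`|_^-1|]gtr0_norm ?invr_gt0// ler_pdivrMr//.
set q' := erlang_tail n.+1 (y + b * e) in t1 t2.
rewrite (_ : A - b * e * q = (A - b * e * q') + b * e * (q' - q)); last by ring.
rewrite (le_trans (ler_normD _ _))//.
have : `|b * e * (q' - q)| <= b * e * (b * e).
  by rewrite normrM (gtr0_norm be0) ler_pM2l.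
rewrite /A; move: t1; rewrite expr2; lra.
Qed.

End LevelFamilies.

(** * Passage to the limit *)

Section HasMean.
Context (d : measure_display) (T : measurableType d) (R : realType)
  (P : probability T R).
Implicit Types (f : T -> R) (v : R).

Import HBNNSimple.

(* The expectation of f is v and f is measurable up to a null set; the functionals
   of Brownian paths of interest are only known to be measurable in that sense. *)
Definition has_mean f v := exists N : set T, [/\ measurable N, P N = 0%E,
  measurable_fun setT (fun w => f w * \1_(~` N) w) &
  (\int[P]_w (f w * \1_(~` N) w)%:E)%E = v%:E].

Lemma has_mean_measurable f v : measurable_fun setT f ->
  (\int[P]_w (f w)%:E)%E = v%:E -> has_mean f v.
Proof.
move=> mf mean; exists set0; rewrite setC0.
have -> : (fun w => f w * \1_setT w) = f by apply/funext => w; rewrite indicT mulr1.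
by split => //; under eq_integral do rewrite indicT mulr1.
Qed.

(** The integral of a nonnegative function is a supremum over the simple functions below it,
    measurable or not; the integral of a simple function ignores the null set [N]. *)
Lemma has_mean_integral f v : (forall w, 0 <= f w) -> has_mean f v ->
  (\int[P]_w (f w)%:E)%E = v%:E.
Proof.
move=> f0 [N [mN N0 mf <-]].
have mNC : measurable (~` N) by exact: measurableC.
have g0 w : 0 <= f w * \1_(~` N) w by rewrite mulr_ge0.
rewrite [LHS]ge0_integralTE; last by move=> w; rewrite lee_fin.
rewrite [RHS]ge0_integralTE; last by move=> w; rewrite lee_fin.
apply/eqP; rewrite eq_le; apply/andP; split; last first.
  apply: ereal_sup_le => _ [h hf <-]; exists h => // w.
  apply: (le_trans (hf w)); rewrite lee_fin; apply: ler_piMr (f0 w) _.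
  by rewrite indicE; case: (_ \in _).
rewrite -[leRHS]ge0_integralTE; last by move=> w; rewrite lee_fin.
apply: ge_ereal_sup => _ [h hf <-]; rewrite -integralT_nnsfun.
have mh : measurable_fun setT (fun w => (h w)%:E) by exact/measurable_EFinP.
rewrite (ge0_negligible_integral mN)//; last by move=> w _; rewrite lee_fin.
rewrite [leRHS](ge0_negligible_integral mN)//;
  [|exact/measurable_EFinP| by move=> w _; rewrite lee_fin].
rewrite setTD; apply: ge0_le_integral => //.
- by move=> w _; rewrite lee_fin.
- exact: measurable_funTS.
- exact/measurable_funTS/measurable_EFinP.
- by move=> w Nw; rewrite (le_trans (hf w))// lee_fin indicE mem_set// mulr1.
Qed.

(** Bounded convergence, once the countable union [M] of all exceptional null sets is removed. *)
Lemma has_mean_lim (f_ : nat -> T -> R) (v_ : nat -> R) f v (N0 : set T) :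
  (forall i, has_mean (f_ i) (v_ i)) -> (forall i w, 0 <= f_ i w <= 1) ->
  measurable N0 -> P N0 = 0%E ->
  (forall w, ~ N0 w -> f_ i w @[i --> \oo] --> f w) ->
  v_ i @[i --> \oo] --> v -> has_mean f v.
Proof.
move=> hm f01 mN0 PN0 ff vv.
have [N HN] := choice hm.
pose M := N0 `|` \bigcup_i N i.
have mN i : measurable (N i) by case: (HN i).
have mM : measurable M by apply: measurableU => //; exact: bigcup_measurable.
have M0 : P M = 0%E.
  apply: (negligibleP P mM).1; apply: negligibleU; first exact: (negligibleP P mN0).2.
  apply: negligible_bigcup => i; apply: (negligibleP P (mN i)).2.
  by case: (HN i).
have mMC : measurable (~` M) by exact: measurableC.
have fE i w : f_ i w * \1_(~` M) w = f_ i w * \1_(~` N i) w * \1_(~` M) w.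
  rewrite !indicE !in_setC; have [wM|wM] := boolP (w \in M); rewrite ?mulr0 ?mulr1//=.
  rewrite (_ : w \in N i = false) ?mulr1//; apply/negbTE; apply: contra wM.
  by rewrite !inE => Nw; right; exists i.
have mg i : measurable_fun setT (fun w => f_ i w * \1_(~` M) w).
  rewrite (_ : (fun w => _) = fun w => f_ i w * \1_(~` N i) w * \1_(~` M) w).
    apply: measurable_funM; first by case: (HN i).
    exact: measurable_indic.
  by apply/funext => w; exact: fE.
have cg w : f_ i w * \1_(~` M) w @[i --> \oo] --> f w * \1_(~` M) w.
  rewrite !indicE in_setC; have [wM|wM] := boolP (w \in M) => /=.
    by rewrite mulr0; under eq_fun do rewrite mulr0; exact: cvg_cst.
  rewrite mulr1; under eq_fun do rewrite mulr1; apply: ff => N0w.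
  by move/negP: wM; apply; rewrite inE; left.
have mgf : measurable_fun setT (fun w => f w * \1_(~` M) w).
  by apply: (measurable_fun_cvg (h := fun i w => f_ i w * \1_(~` M) w)).
exists M; split => //.
have mE i : (\int[P]_w (f_ i w * \1_(~` M) w)%:E = (v_ i)%:E)%E.
  have [mNi N0i mi <-] := HN i.
  apply: ae_eq_integral => //; [exact/measurable_EFinP|exact/measurable_EFinP|].
  exists M; split => // w /= /not_implyP[_ neq]; apply: contrapT => wM; apply: neq.
  rewrite /= fE (_ : \1_(~` M) w = 1) ?mulr1//.
  by rewrite indicE mem_set.
have dom i w : (`|(f_ i w * \1_(~` M) w)%:E| <= 1%:E)%E.
  have /andP[h0 h1] := f01 i w.
  rewrite abse_EFin lee_fin ger0_norm ?mulr_ge0//; apply: le_trans (ler_piMr h0 _) h1.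
  by rewrite indicE; case: (_ \in _).
have cgE w : (f_ i w * \1_(~` M) w)%:E @[i --> \oo] --> (f w * \1_(~` M) w)%:E.
  by apply: cvg_EFin (cg w); exact: nearW.
have [_ _ conv] := dominated_convergence (mu := P) measurableT
  (fun i => (measurable_EFinP _ _).2 (mg i)) ((measurable_EFinP _ _).2 mgf)
  (aeW _ (fun w (_ : setT w) => cgE w))
  (finite_measure_integrable_cst P 1 measurableT) (aeW _ (fun w i (_ : setT w) => dom i w)).
have conv' : (\int[P]_w (f_ i w * \1_(~` M) w)%:E)%E @[i --> \oo] --> v%:E.
  by under eq_fun do rewrite mE; apply: cvg_EFin vv; exact: nearW.
exact: (cvg_unique _ conv conv').
Qed.

End HasMean.

(** * Brownian motion sampled on the dyadic grids *)

Section BrownianIncrements.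
Context (d : measure_display) (T : measurableType d) (R : realType)
  (P : probability T R) (W : R -> {RV P >-> R}).
Hypothesis HW : standard_brownian_motion W.

Definition bm_increment (h : R) (j : nat) (w : T) : R :=
  W (h * j.+1%:R) w - W (h * j%:R) w.

Lemma bm_increments h : 0 < h ->
  exists nu : probability R R, forall N, increments_spec P h nu (bm_increment h) N.
Proof.
move=> h0.
have mincr j : measurable_fun setT (bm_increment h j).
  exact: measurable_funB.
pose X : {mfun T >-> R} :=
  HB.pack (bm_increment h 0) (isMeasurableFun.Build _ _ _ _ _ (mincr 0%N)).
have lawE j (A : set R) : measurable A ->
    P (bm_increment h j @^-1` A) = normal_prob 0 (Num.sqrt h) A.
  move=> mA; have hj0 : 0 <= h * j%:R by rewrite mulr_ge0// ltW.
  have hjj : h * j%:R < h * j.+1%:R by rewrite ltr_pM2l// ltr_nat.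
  have hE : h * j.+1%:R - h * j%:R = h by rewrite -natr1; ring.
  by have := sbm_gaussian_increments HW hj0 hjj mA; rewrite hE.
exists (distribution P X) => N.
have nuE (A : set R) : measurable A ->
    distribution P X A = normal_prob 0 (Num.sqrt h) A by exact: lawE.
split => //.
  move=> t; rewrite (normal_law_mgf t (sd := Num.sqrt h))//; last first.
    by rewrite gt_eqF// sqrtr_gt0.
  by rewrite sqr_sqrtr// ltW.
move=> B mB.
have t0 : 0 <= h * 0%:R by rewrite mulr0.
have tmono : {homo (fun i : nat => h * i%:R) : i j / (i <= j)%N >-> i <= j}.
  by move=> i j ij; rewrite ler_pM2l// ler_nat.
have := sbm_independent_increments HW (n := N) t0 tmono (B := fun i : 'I_N => B i)
  (fun i => mB i).
rewrite [X in P X](_ : _ = [set w | forall i, (i < N)%N -> B i (bm_increment h i w)]).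
  move=> ->; apply: eq_bigr => i _.
  exact: etrans (lawE i _ (mB i)) (esym (nuE _ (mB i))).
apply/seteqP; split => w /= H.
  by move=> i iN; exact: (H (Ordinal iN)).
by move=> i _; exact: H.
Qed.

End BrownianIncrements.

Section GridDiscount.
Context (R : realType).
Implicit Types (a lambda t : R) (x : R -> R) (tau : \bar R).

Lemma discountE lambda t : discount lambda t%:E = expR (- (lambda * t)).
Proof. by rewrite /discount -EFinM -EFinN. Qed.

Lemma discount_infty lambda : 0 < lambda -> discount lambda +oo%E = 0.
Proof. by move=> l0; rewrite /discount gt0_muley// lte_fin. Qed.

Lemma discount_ge0 lambda tau : 0 <= discount lambda tau.
Proof. by rewrite /discount fine_ge0// expeR_ge0. Qed.

Context (mu sigma lambda : R) (lambda_gt0 : 0 < lambda).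
Context (n : nat) (n_gt0 : (0 < n)%N).
Context (d : measure_display) (T : measurableType d) (P : probability T R)
  (W : R -> {RV P >-> R}).

Local Notation path w := (fun t => drifted_brownian_motion mu sigma W t w).
Local Notation grid w m := (fun i : nat => path w (mesh R m * i%:R)).

Definition bm_state a m (w : T) : state R :=
  grid_state mu sigma a n (fun m => bm_increment W (mesh R m)) m w.

Definition bm_discount a m (w : T) : R :=
  grid_discount mu sigma a lambda n (fun m => bm_increment W (mesh R m)) m w.

Lemma bm_tracks a m w : 0 < a ->
  tracks n a (grid w m) (4 ^ m) (bm_state a m w).
Proof.
move=> a0.
apply: (chain_tracks a0 (h := mesh R m) (mu := mu) (sigma := sigma) n_gt0
   (xi := fun i => bm_increment W (mesh R m) i w)) => // i.
rewrite /drifted_brownian_motion /bm_increment -natr1.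
by ring.
Qed.

Variant bm_discount_spec a m w : R -> Prop :=
| BmAbsorbed J of (J <= 4 ^ m)%N & drops a (grid w m) n J &
    (forall i, (i < J)%N -> ~ drops a (grid w m) n i) &
    (bm_state a m w).2.2 = path w (mesh R m * J%:R) - path w 0 :
    bm_discount_spec a m w (expR (- (lambda * mesh R m * J%:R)))
| BmActive of ~ drops a (grid w m) n (4 ^ m) : bm_discount_spec a m w 0.

Lemma bm_discountP a m w : 0 < a -> bm_discount_spec a m w (bm_discount a m w).
Proof.
move=> a0; have [kn] := bm_tracks m w a0.
rewrite /bm_discount /grid_discount /discount_factor -/(bm_state a m w).
case: ifP => [lt_kn [_ _ _ nd _]|ge_kn [JN dJ ndJ XE]].
  by rewrite ltn_eqF//; constructor => dn; apply: nd; exact: drops_le dn.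
rewrite eqn_leq kn leqNgt ge_kn /=; constructor => //.
by rewrite XE mulr0.
Qed.

Lemma bm_discount_le a m w : 0 < a ->
  bm_discount a m w <= discount lambda (drawdown_time a (path w) n).
Proof.
move=> a0; case: (bm_discountP m w a0) => [J _ dJ _ _|_]; last exact: discount_ge0.
have := drawdown_time_le (x := path w) (mesh_gt0 R m) dJ; have := drawdown_time_ge0 a (path w) n.
case: (drawdown_time _ _ _) => [t| |]//; rewrite !lee_fin => t0 tJ.
by rewrite discountE ler_expR lerN2 -mulrA ler_pM2l.
Qed.

Lemma bm_discount_ge a m w j : 0 < a -> (j <= 4 ^ m)%N ->
  drops a (grid w m) n j -> expR (- (lambda * (mesh R m * j%:R))) <= bm_discount a m w.
Proof.
move=> a0 jm dj; case: (bm_discountP m w a0) => [J _ dJ ndJ _|nd]; last first.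
  by case: nd; exact: dropsW dj.
rewrite ler_expR lerN2 -[leLHS]mulrA ler_pM2l// ler_pM2l ?mesh_gt0// ler_nat.
by rewrite leqNgt; apply/negP => /ndJ.
Qed.

Lemma bm_discount_homo a w : 0 < a ->
  {homo (fun m => bm_discount a m w) : m m' / (m <= m')%N >-> m <= m'}.
Proof.
move=> a0; apply: homo_leq => // [y x z|m]; first exact: le_trans.
case: (bm_discountP m w a0) => [J Jm dJ _ _|_]; last exact: discount_factor_ge0.
have h2 : mesh R m.+1 * (2 * J)%:R = mesh R m * J%:R.
  by rewrite /mesh exprS natrM; field.
rewrite -mulrA -h2; apply: bm_discount_ge => //.
  by rewrite expnS leq_mul.
apply: drops_refine dJ => i /=; congr (path w _).
by rewrite /mesh exprS natrM; field.
Qed.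

Lemma bm_discount_level a a' m w : 0 < a' -> a' <= a ->
  bm_discount a m w <= bm_discount a' m w.
Proof.
move=> a'0 aa; have a0 := lt_le_trans a'0 aa.
case: (bm_discountP m w a0) => [J Jm dJ _ _|_]; last exact: discount_factor_ge0.
by rewrite -mulrA; apply: bm_discount_ge => //; exact: drops_level dJ.
Qed.

Lemma bm_discount_eventually a a' w (e : R) : continuous_path (path w) ->
  0 < a' -> a' < a -> 0 < e ->
  \forall m \near \oo,
    discount lambda (drawdown_time a (path w) n) - e <= bm_discount a' m w.
Proof.
move=> cx a'0 aa e0.
have ge0 := drawdown_time_ge0 a (path w) n.
case tauE : (drawdown_time a (path w) n) ge0 => [t| |]// t0; last first.
  rewrite discount_infty//; near=> m; rewrite sub0r.
  by apply: (@le_trans _ _ 0); rewrite ?oppr_le0 ?(ltW e0)// discount_factor_ge0.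
rewrite lee_fin in t0; rewrite discountE.
(* Waiting [e / lambda] longer multiplies the discount factor by [exp (- e) >= 1 - e], and gives
   [drops_eventually] its strict inequality. *)
pose t' := t + e / lambda.
have t'p : 0 < t' by rewrite ltr_wpDl// divr_gt0.
have t'0 := ltW t'p.
have tt' : (drawdown_time a (path w) n < t'%:E)%E.
  by rewrite tauE lte_fin ltrDl divr_gt0.
near=> m.
have dj : drops a' (grid w m) n (grid_index m t').
  by near: m; exact: drops_eventually cx a'0 aa tt'.
have /andP[g1 g2] := grid_point_bounds m t'0.
have jm : (grid_index m t' <= 4 ^ m)%N.
  have small : mesh R m < t'^-1 by near: m; apply: mesh_lt; rewrite invr_gt0.
  rewrite -(ler_nat R) -(ler_pM2l (mesh_gt0 R m)) mesh_horizon (le_trans g1)//.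
  rewrite (_ : 2 ^+ m = (mesh R m)^-1); last by rewrite /mesh exprVn invrK.
  by rewrite -[leLHS]invrK lef_pV2 ?posrE ?invr_gt0 ?mesh_gt0// ltW.
apply: le_trans (bm_discount_ge a'0 jm dj).
apply: (@le_trans _ _ (expR (- (lambda * t')))); last by rewrite ler_expR lerN2 ler_pM2l.
have le1 : expR (- (lambda * t)) <= 1.
  by rewrite -expR0 ler_expR oppr_le0 mulr_ge0// ltW.
rewrite (_ : - (lambda * t') = - (lambda * t) + - e); last first.
  by rewrite /t'; field; rewrite gt_eqF.
rewrite expRD; have := expR_ge1Dx (- e); have := expR_gt0 (- (lambda * t)); nra.
Unshelve. all: by end_near.
Qed.

(** A positive discount factor determines the time of the n-th drawdown on the grid, so its
    convergence will give that of the time, and by continuity that of the position. *)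
Lemma bm_discount_position a m w : 0 < a -> 0 < bm_discount a m w ->
  exists t, [/\ 0 <= t, bm_discount a m w = expR (- (lambda * t)) &
    (bm_state a m w).2.2 = path w t - path w 0].
Proof.
move=> a0; case: (bm_discountP m w a0) => [J Jm _ _ XE _|_]; last by rewrite ltxx.
exists (mesh R m * J%:R); split => //; last by rewrite mulrA.
by rewrite mulr_ge0// ltW// mesh_gt0.
Qed.

End GridDiscount.

Section DiscountLimit.
Context (d : measure_display) (T : measurableType d) (R : realType)
  (P : probability T R) (W : R -> {RV P >-> R}).
Hypothesis HW : standard_brownian_motion W.
Context (mu sigma lambda : R).
Hypotheses (sigma_gt0 : 0 < sigma) (lambda_gt0 : 0 < lambda).
Context (n : nat) (n_gt0 : (0 < n)%N).
Implicit Types a x e : R.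

Local Notation path w := (fun t => drifted_brownian_motion mu sigma W t w).
Local Notation b a := (b_const mu sigma a lambda).
Local Notation c a := (c_const mu sigma a lambda).
Local Notation bmd := (bm_discount mu sigma lambda n W).
Local Notation bms := (bm_state mu sigma n W).

Lemma within_continuous_path (f : R -> R) :
  {within `[0, +oo[, continuous f} -> continuous_path f.
Proof.
move=> /subspace_continuousP cf u e u0 e0.
have /cf : `[0, +oo[%classic u by rewrite /= in_itv /= u0.
move=> /cvgrPdist_lt /(_ e e0); rewrite near_withinE => /nbhs_ballP[del /= del0 H].
exists del => // v v0 vu; rewrite distrC; apply: H; first by rewrite /ball /= distrC.
by rewrite /= in_itv /= v0.
Qed.

Lemma good_paths : exists N : set T, [/\ measurable N, P N = 0%E &
  forall w, ~ N w -> path w 0 = 0 /\ continuous_path (path w)].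
Proof.
have [N1 [mN1 PN1 H1]] := sbm_start HW.
have [N2 [mN2 PN2 H2]] := sbm_continuous_paths HW.
exists (N1 `|` N2); split; first exact: measurableU.
  by rewrite null_set_setU.
move=> w /not_orP[n1 n2].
have W0 : W 0 w = 0 by apply: contrapT => h; apply: n1; exact: H1.
have cW : {within `[0, +oo[, continuous (fun t : R => W t w)}.
  by apply: contrapT => h; apply: n2; exact: H2.
split; first by rewrite /drifted_brownian_motion W0 !mulr0 addr0.
have cp := within_continuous_path cW => u e u0 e0.
have smu : 0 < `|mu| + 1 by exact: ltr_wpDl.
have es0 : 0 < e / 2 / sigma by rewrite !divr_gt0.
have [del del0 H] := cp u (e / 2 / sigma) u0 es0.
have d0 : 0 < Num.min del (e / 2 / (`|mu| + 1)) by rewrite lt_min del0 !divr_gt0.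
exists (Num.min del (e / 2 / (`|mu| + 1))) => // v v0; rewrite lt_min => /andP[v1 v2].
rewrite /drifted_brownian_motion.
rewrite (_ : _ - _ = mu * (v - u) + sigma * (W v w - W u w)); last by ring.
rewrite (le_lt_trans (ler_normD _ _))// !normrM (gtr0_norm sigma_gt0).
have h1 := H v v0 v1; rewrite ltr_pdivlMr// mulrC in h1.
have h2 : `|mu| * `|v - u| <= e / 2.
  rewrite ltr_pdivlMr// in v2; apply: le_trans (ltW v2).
  by rewrite mulrC ler_wpM2l// lerDl.
by lra.
Qed.

Lemma bm_spec : exists nu : nat -> probability R R,
  forall m, increments_spec P (mesh R m) (nu m) (bm_increment W (mesh R m)) (4 ^ m).
Proof.
have [nu Hnu] := choice (fun m => bm_increments HW (mesh_gt0 R m)).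
by exists nu => m; exact: Hnu.
Qed.

Lemma measurable_bm_state a m : measurable_fun setT (bms a m).
Proof. by have [nu Hnu] := bm_spec; exact: measurable_grid_state Hnu m. Qed.

Lemma measurable_bm_discount a m : measurable_fun setT (bmd a m).
Proof.
apply: (measurableT_comp (f := discount_factor lambda n (mesh R m)) (g := bms a m)).
  exact: measurable_discount_factor.
exact: measurable_bm_state.
Qed.

Lemma bm_discount_bounds a m w : 0 <= bmd a m w <= 1.
Proof. by rewrite discount_factor_ge0 discount_factor_le1// ltW// mesh_gt0. Qed.

Lemma bm_reward_cvg a V C : 0 < a -> level_values mu sigma a lambda n V C ->
  (forall m, 0 <= V n m <= 1) ->
  exists2 v : nat -> R, (forall m, has_mean P (fun w => bmd a m w * V n (bms a m w).2.2) (v m)) &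
    v m @[m --> \oo] --> V 0%N 0.
Proof.
move=> a0 HV V01; have [nu Hnu] := bm_spec.
have cv := reward_cvg sigma_gt0 a0 lambda_gt0 n_gt0 Hnu HV.
pose r m w := bmd a m w * V n (bms a m w).2.2.
have ir m : P.-integrable setT (fun w => (r m w)%:E).
  apply: (reward_integrable lambda_gt0 P HV (ltW (mesh_gt0 R m))).
  exact: measurable_bm_state.
exists (fun m => fine (\int[P]_w (r m w)%:E)%E); last by apply: fine_cvg.
move=> m; apply: has_mean_measurable.
  by apply/measurable_EFinP; exact: measurable_int (ir m).
by rewrite fineK//; exact: integrable_fin_num.
Qed.

Definition limit_discount a w : R := limn (fun m => bmd a m w).

Lemma limit_discount_cvg a w : 0 < a ->
  bmd a m w @[m --> \oo] --> limit_discount a w.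
Proof.
move=> a0; apply: nondecreasing_is_cvgn; first exact: bm_discount_homo.
by exists 1 => _ [m _ <-]; case/andP: (bm_discount_bounds a m w).
Qed.

Lemma bm_discount_le_limit a m w : 0 < a -> bmd a m w <= limit_discount a w.
Proof.
move=> a0; apply: nondecreasing_cvgn_le; first exact: bm_discount_homo.
by apply/cvg_ex; exists (limit_discount a w); exact: limit_discount_cvg.
Qed.

Lemma limit_discount_bounds a w : 0 < a -> 0 <= limit_discount a w <= 1.
Proof.
move=> a0; have cv := @limit_discount_cvg a w a0; apply/andP; split.
  have /andP[h _] := bm_discount_bounds a 0 w.
  exact: le_trans h (bm_discount_le_limit _ _ a0).
apply: limr_le; first by apply/cvg_ex; exists (limit_discount a w).
by apply: nearW => m; case/andP: (bm_discount_bounds a m w).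
Qed.

Lemma measurable_limit_discount a : 0 < a -> measurable_fun setT (limit_discount a).
Proof.
move=> a0; apply: (measurable_fun_cvg (h := fun m w => bmd a m w)) => [m|w _].
  exact: measurable_bm_discount.
exact: limit_discount_cvg.
Qed.

Lemma has_mean_limit_discount a : 0 < a ->
  has_mean P (limit_discount a) ((c a / b a) ^+ n).
Proof.
move=> a0; have [C HV] := level_values_const mu sigma_gt0 a0 lambda_gt0 n.
have V01 (m : R) : 0 <= (fun (k : nat) (_ : R) => (c a / b a) ^+ (n - k)) n m <= 1.
  by rewrite subnn expr0 ler01 lexx.
have [v vm vv] := bm_reward_cvg a0 HV V01.
rewrite subn0 in vv.
apply: (has_mean_lim (f_ := bmd a) (N0 := set0) _ _ _ _ _ vv) => //.
- move=> i; have := vm i; rewrite subnn expr0.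
  by under eq_fun do rewrite mulr1.
- by move=> i w; exact: bm_discount_bounds.
- by move=> w _; exact: limit_discount_cvg.
Qed.

End DiscountLimit.

(** * The almost sure limit of the discount factor *)

Section RatioContinuity.
Context (R : realType) (mu sigma lambda : R).
Hypotheses (sigma_gt0 : 0 < sigma) (lambda_gt0 : 0 < lambda).
Implicit Types a : R.

Local Notation bp := (beta_plus mu sigma lambda).
Local Notation bm := (beta_minus mu sigma lambda).
Local Notation ratio a :=
  (c_const mu sigma a lambda / b_const mu sigma a lambda).

(** The exponential gap cancels, which leaves an expression visibly continuous in [a]. *)
Lemma ratioE a : 0 < a -> ratio a =
  (bp - bm) / (bp * expR (- bm * a) - bm * expR (- bp * a)).
Proof.
move=> a0; rewrite /c_const /b_const /=.
have g0 := exp_gap_gt0 mu sigma_gt0 a0 lambda_gt0.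
have den0 : 0 < bp * expR (- bm * a) - bm * expR (- bp * a).
  have := beta_plus_gt0 mu sigma_gt0 lambda_gt0.
  have := beta_minus_lt0 mu sigma_gt0 lambda_gt0.
  have := expR_gt0 (- bm * a); have := expR_gt0 (- bp * a); nra.
by field; rewrite !gt_eqF.
Qed.

Lemma ratio_cvg a (u : nat -> R) : 0 < a -> (forall j, 0 < u j) ->
  u j @[j --> \oo] --> a -> ratio (u j) @[j --> \oo] --> ratio a.
Proof.
move=> a0 u0 ua; rewrite ratioE//; under eq_fun do rewrite ratioE//.
have den0 : 0 < bp * expR (- bm * a) - bm * expR (- bp * a).
  have := beta_plus_gt0 mu sigma_gt0 lambda_gt0.
  have := beta_minus_lt0 mu sigma_gt0 lambda_gt0.
  have := expR_gt0 (- bm * a); have := expR_gt0 (- bp * a); nra.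
have ce t : expR (t * u j) @[j --> \oo] --> expR (t * a).
  apply: (cvg_comp (fun j => t * u j) expR); last exact: continuous_expR.
  by apply: cvgM => //; exact: cvg_cst.
apply: cvgM; first exact: cvg_cst.
apply: cvgV; first by rewrite gt_eqF.
by apply: cvgB; apply: cvgM => //; exact: cvg_cst.
Qed.

End RatioContinuity.

Section AlmostSureLimit.
Context (d : measure_display) (T : measurableType d) (R : realType)
  (P : probability T R) (W : R -> {RV P >-> R}).
Hypothesis HW : standard_brownian_motion W.
Context (mu sigma lambda : R).
Hypotheses (sigma_gt0 : 0 < sigma) (lambda_gt0 : 0 < lambda).
Context (n : nat) (n_gt0 : (0 < n)%N).
Implicit Types a x e : R.

Local Notation path w := (fun t => drifted_brownian_motion mu sigma W t w).
Local Notation b a := (b_const mu sigma a lambda).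
Local Notation c a := (c_const mu sigma a lambda).
Local Notation bmd := (bm_discount mu sigma lambda n W).
Local Notation bms := (bm_state mu sigma n W).
Local Notation lim_disc := (limit_discount W mu sigma lambda n).
Local Notation disc a w := (discount lambda (drawdown_time a (path w) n)).

Lemma limit_discount_le a w : 0 < a -> lim_disc a w <= disc a w.
Proof.
move=> a0; apply: limr_le.
  by apply/cvg_ex; exists (lim_disc a w); exact: limit_discount_cvg.
by apply: nearW => m; exact: bm_discount_le.
Qed.

Lemma limit_discount_ge a a' w : continuous_path (path w) -> 0 < a' -> a' < a ->
  disc a w <= lim_disc a' w.
Proof.
move=> cx a'0 aa; apply/ler_addgt0Pr => e e0; rewrite -lerBlDr.
apply: limr_ge; first by apply/cvg_ex; exists (lim_disc a' w); exact: limit_discount_cvg.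
exact: bm_discount_eventually.
Qed.

(* The limiting discount factor decreases strictly below the discount factor of
   the drawdown time only on a null set, because its mean (c/b)^n is continuous
   in a. *)
Lemma ae_discount_cvg a : 0 < a -> exists N : set T, [/\ measurable N, P N = 0%E &
  forall w, ~ N w -> [/\ path w 0 = 0, continuous_path (path w) &
    bmd a m w @[m --> \oo] --> disc a w]].
Proof.
move=> a0; have [N0 [mN0 PN0 good]] := good_paths HW mu sigma_gt0.
pose u (j : nat) : R := a - a * mesh R j.+1.
have mj j : 0 < mesh R j.+1 < 1.
  by rewrite mesh_gt0 exprn_ilt1// ?invr_ge0// invf_lt1// ltr1n.
have u0 j : 0 < u j.
  by rewrite subr_gt0 gtr_pMr//; case/andP: (mj j).
have ua j : u j < a.
  by rewrite ltrBlDr ltrDl mulr_gt0//; case/andP: (mj j).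
have uu i j : (i <= j)%N -> u i <= u j.
  by move=> ij; rewrite lerB// ler_wpM2l ?(ltW a0)// ler_wiXn2l ?invr_ge0 ?invf_le1 ?ler1n.
have u_cvg : u j @[j --> \oo] --> a.
  apply/cvgrPdist_lt => e e0; near=> j.
  rewrite /u opprB addrC subrK ger0_norm; last by rewrite mulr_ge0 ?ltW ?mesh_gt0.
  have : mesh R j < e / a by near: j; apply: mesh_lt; rewrite divr_gt0.
  rewrite ltr_pdivlMr// mulrC; apply: le_lt_trans.
  by rewrite ler_wpM2l ?(ltW a0)// ler_wiXn2l ?invr_ge0 ?invf_le1 ?ler1n.
have mono w : {homo (fun j => lim_disc (u j) w) : i j / (i <= j)%N >-> i >= j}.
  move=> i j ij; apply: ler_lim.
  - by apply/cvg_ex; exists (lim_disc (u j) w); exact: limit_discount_cvg.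
  - by apply/cvg_ex; exists (lim_disc (u i) w); exact: limit_discount_cvg.
  - by apply: nearW => m; apply: bm_discount_level => //; exact: uu.
(* On continuous paths the discount factor of the drawdown time lies between [lim_disc a] and [G];
   as these have the same mean, all three coincide almost surely. *)
pose G w := limn (fun j => lim_disc (u j) w).
have cG w : lim_disc (u j) w @[j --> \oo] --> G w.
  apply: nonincreasing_is_cvgn; first exact: mono.
  by exists 0 => _ [j _ <-]; case/andP: (limit_discount_bounds W mu sigma lambda_gt0 n_gt0 w (u0 j)).
have hG : has_mean P G ((c a / b a) ^+ n).
  have rc := ratio_cvg sigma_gt0 lambda_gt0 a0 u0 u_cvg (mu := mu).
  have rcn : (c (u j) / b (u j)) ^+ n @[j --> \oo] --> (c a / b a) ^+ n.
    exact: (cvg_comp _ _ rc (@exprn_continuous R n _)).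
  apply: (has_mean_lim (f_ := fun j => lim_disc (u j)) (N0 := set0) _ _ _ _ _ rcn) => //.
  - by move=> j; exact: (has_mean_limit_discount HW).
  - by move=> j w; exact: limit_discount_bounds.
have hL := has_mean_limit_discount HW mu sigma_gt0 lambda_gt0 n_gt0 a0.
have mL := measurable_limit_discount HW mu sigma lambda_gt0 n_gt0 a0.
have mG : measurable_fun setT G.
  apply: (measurable_fun_cvg (h := fun j w => lim_disc (u j) w)) => [j|w _].
    exact: (measurable_limit_discount HW).
  exact: cG.
have L01 w := limit_discount_bounds W mu sigma lambda_gt0 n_gt0 w a0.
have LG w : lim_disc a w <= G w.
  apply: limr_ge; first by apply/cvg_ex; exists (G w); exact: cG.
  apply: nearW => j; apply: ler_lim.
  - by apply/cvg_ex; exists (lim_disc a w); exact: limit_discount_cvg.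
  - by apply/cvg_ex; exists (lim_disc (u j) w); exact: limit_discount_cvg.
  - by apply: nearW => m; apply: bm_discount_level => //; exact: ltW.
have G1 w : G w <= 1.
  apply: limr_le; first by apply/cvg_ex; exists (G w); exact: cG.
  by apply: nearW => j; case/andP: (limit_discount_bounds W mu sigma lambda_gt0 n_gt0 w (u0 j)).
have G0 w : 0 <= G w by apply: le_trans (LG w); case/andP: (L01 w).
have iE (f : T -> R) : measurable_fun setT f -> (forall w, 0 <= f w <= 1) ->
    P.-integrable setT (EFin \o f).
  move=> mf f01; apply: measurable_bounded_integrable => //.
    exact: le_lt_trans (probability_le1 P measurableT) (ltry 1).
  exists 1; split; first exact: num_real.
  move=> M /ltW M1 w _ /=; apply: le_trans M1.
  by have /andP[h0 h1] := f01 w; rewrite ger0_norm.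
have iL := iE _ mL L01.
have iG : P.-integrable setT (EFin \o G) by apply: iE => // w; rewrite G0 G1.
have int0 : (\int[P]_w (`|(G w - lim_disc a w)%:E|) = 0)%E.
  transitivity (\int[P]_w ((EFin \o G) w - (EFin \o lim_disc a) w))%E.
    by apply: eq_integral => w _; rewrite abse_EFin ger0_norm// subr_ge0.
  rewrite integralB// (has_mean_integral G0 hG).
  rewrite (has_mean_integral _ hL) ?subee// => w; by case/andP: (L01 w).
have mGL : measurable_fun setT (fun w => (G w - lim_disc a w)%:E).
  by apply/measurable_EFinP; exact: measurable_funB.
have [N1 [mN1 PN1 H1]] := (ae_eq_integral_abs P measurableT mGL).1 int0.
exists (N0 `|` N1); split; first exact: measurableU.
  by rewrite null_set_setU.
move=> w /not_orP[n0 n1]; have [p0 cp] := good w n0; split => //.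
have GLw : G w = lim_disc a w.
  apply/eqP; rewrite -subr_eq0; apply/eqP; apply: contrapT => ne.
  by apply: n1; apply: H1 => /= /(_ I) [].
suff -> : disc a w = lim_disc a w by exact: limit_discount_cvg.
apply/eqP; rewrite eq_le limit_discount_le// andbT -GLw.
apply: limr_ge; first by apply/cvg_ex; exists (G w); exact: cG.
by apply: nearW => j; exact: limit_discount_ge.
Unshelve. all: by end_near.
Qed.

End AlmostSureLimit.

(** * Rewards at the n-th drawdown time *)

Section DrawdownMean.
Context (d : measure_display) (T : measurableType d) (R : realType)
  (P : probability T R) (W : R -> {RV P >-> R}).
Hypothesis HW : standard_brownian_motion W.
Context (mu sigma lambda a : R).
Hypotheses (sigma_gt0 : 0 < sigma) (lambda_gt0 : 0 < lambda) (a_gt0 : 0 < a).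
Context (n : nat) (n_gt0 : (0 < n)%N).
Implicit Types x e t : R.

Local Notation path w := (fun t => drifted_brownian_motion mu sigma W t w).
Local Notation b := (b_const mu sigma a lambda).
Local Notation c := (c_const mu sigma a lambda).
Local Notation bmd := (bm_discount mu sigma lambda n W).
Local Notation bms := (bm_state mu sigma n W).
Local Notation tau w := (drawdown_time a (path w) n).
Local Notation disc w := (discount lambda (tau w)).

Lemma level_values_cvg V C x (u : nat -> R) : level_values mu sigma a lambda n V C ->
  u i @[i --> \oo] --> x -> V n (u i) @[i --> \oo] --> V n x.
Proof.
move=> HV /cvgrPdist_lt ux; have C0 := level_ge0 HV.
have lip y z : y <= z -> `|V n y - V n z| <= C * (z - y).
  move=> yz; have := level_lipschitz HV z (leqnn n) (r := z - y).
  by rewrite subr_ge0 subKr; apply.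
have lip2 y z : `|V n y - V n z| <= C * `|y - z|.
  have [yz|zy] := leP y z.
    by rewrite [`|y - z|]distrC (ger0_norm (_ : 0 <= z - y)) ?subr_ge0// lip.
  by rewrite distrC [`|y - z|]gtr0_norm ?subr_gt0// lip// ltW.
have C1 : 0 < C + 1 by rewrite ltr_wpDl.
apply/cvgrPdist_lt => e e0; near=> i.
apply: (le_lt_trans (lip2 _ _)).
have : `|x - u i| < e / (C + 1) by near: i; apply: ux; exact: divr_gt0.
rewrite ltr_pdivlMr// mulrDr mulr1 mulrC; apply: le_lt_trans.
by rewrite lerDl.
Unshelve. all: by end_near.
Qed.

Lemma bm_reward_pointwise_cvg V C w : level_values mu sigma a lambda n V C ->
  (forall m, 0 <= V n m <= 1) -> path w 0 = 0 -> continuous_path (path w) ->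
  bmd a m w @[m --> \oo] --> disc w ->
  bmd a m w * V n (bms a m w).2.2 @[m --> \oo] --> disc w * V n (path w (fine (tau w))).
Proof.
move=> HV V01 p0 cp; have := drawdown_time_ge0 a (path w) n.
(* For [tau = +oo] the product is squeezed to 0: the discount factor tends to 0 and the reward stays
   in [[0, 1]]. *)
case: (tau w) => [t| |]// t0; last first.
  rewrite discount_infty// mul0r => cd.
  apply: (squeeze_cvgr (f := fun=> 0) (h := fun m => bmd a m w)) cd; last exact: cvg_cst.
  apply: nearW => m.
  have /andP[v0 v1] := V01 (bms a m w).2.2.
  have b0 : 0 <= bmd a m w by exact: discount_factor_ge0.
  by rewrite mulr_ge0// ler_piMr.
rewrite lee_fin in t0; rewrite discountE /= => cd.
apply: cvgM => //; apply: (level_values_cvg HV).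
apply/cvgrPdist_lt => e e0.
have [del del0 Hdel] := cp t e t0 e0.
(* Enclosing the discount factor between its values at [t + del] and [t - del] places the drawdown
   time of the grid within [del] of [t]. *)
have l1 : expR (- (lambda * (t + del))) < expR (- (lambda * t)).
  by rewrite ltr_expR ltrN2 ltr_pM2l// ltrDl.
have l2 : expR (- (lambda * t)) < expR (- (lambda * (t - del))).
  by rewrite ltr_expR ltrN2 ltr_pM2l// gtrBl.
near=> m.
have h1 : expR (- (lambda * (t + del))) < bmd a m w.
  by near: m; exact: (cvgr_gt _ cd).
have h2 : bmd a m w < expR (- (lambda * (t - del))).
  by near: m; exact: (cvgr_lt _ cd).
have [s [s0 sE ->]] := bm_discount_position n_gt0 a_gt0 (lt_trans (expR_gt0 _) h1).
rewrite p0 subr0 distrC; apply: Hdel => //.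
move: h1 h2; rewrite sE !ltr_expR !ltrN2 !ltr_pM2l// => h1 h2.
by rewrite ltr_distl h2.
Unshelve. all: by end_near.
Qed.

Lemma disc_bounds w : 0 <= disc w <= 1.
Proof.
rewrite discount_ge0 /=; have := drawdown_time_ge0 a (path w) n.
case: (tau w) => [t| |]// t0; last by rewrite discount_infty.
by rewrite discountE -expR0 ler_expR oppr_le0 mulr_ge0// ltW.
Qed.

Lemma has_mean_ramp x e : 0 < e -> has_mean P
  (fun w => disc w * ramp_values mu sigma a lambda x e n n (path w (fine (tau w))))
  (ramp_values mu sigma a lambda x e n 0 0).
Proof.
move=> e0; have [C HV] := level_values_ramp mu sigma_gt0 a_gt0 lambda_gt0 x n e0.
have V01 m := ramp_terminal_bounds mu sigma_gt0 a_gt0 lambda_gt0 x n m e0.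
have [v vm vv] := bm_reward_cvg HW sigma_gt0 lambda_gt0 n_gt0 a_gt0 HV V01.
have [N [mN PN good]] := ae_discount_cvg HW mu sigma_gt0 lambda_gt0 n_gt0 a_gt0.
apply: (has_mean_lim vm _ mN PN _ vv) => [i w|w Nw].
  have /andP[v0 v1] := V01 (bms a i w).2.2.
  have /andP[b0 b1] := bm_discount_bounds W mu sigma lambda_gt0 n a i w.
  by rewrite mulr_ge0//= mulr_ile1.
have [p0 cp cd] := good w Nw.
exact: bm_reward_pointwise_cvg HV V01 p0 cp cd.
Qed.

Lemma has_mean_drawdown x : 0 < x -> has_mean P
  (fun w => disc w *
    \1_[set w | (tau w < +oo)%E /\ x < path w (fine (tau w))] w)
  ((c / b) ^+ n * erlang_tail n (b * (x + n%:R * a))).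
Proof.
move=> x0; pose e (i : nat) : R := i.+1%:R^-1.
have e0 i : 0 < e i by rewrite invr_gt0 ltr0n.
have ecvg : e i @[i --> \oo] --> 0 by exact: cvg_harmonic.
have rcvg : ramp_values mu sigma a lambda x (e i) n 0 0 @[i --> \oo] -->
    (c / b) ^+ n * erlang_tail n (b * (x + n%:R * a)).
  set K := (c / b) ^+ n * (2 * b).
  have Ke : K * e i @[i --> \oo] --> 0.
    by rewrite -[0 in X in _ --> X](mulr0 K); apply: cvgM => //; exact: cvg_cst.
  move/cvgrPdist_lt: Ke => Ke; apply/cvgrPdist_lt => z z0; near=> i; rewrite distrC.
  apply: le_lt_trans (ramp_initial mu sigma_gt0 a_gt0 lambda_gt0 x0 (e0 i) n_gt0) _.
  rewrite -/K; apply: le_lt_trans (ler_norm _) _.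
  by rewrite -[K * _]opprK normrN -sub0r; near: i; apply: Ke.
apply: (has_mean_lim (fun i => has_mean_ramp x (e0 i)) _ measurable0 (measure0 P) _ rcvg).
  move=> i w; have /andP[d0 d1] := disc_bounds w.
  have /andP[v0 v1] := ramp_terminal_bounds mu sigma_gt0 a_gt0 lambda_gt0 x n
    (path w (fine (tau w))) (e0 i).
  by rewrite mulr_ge0//= mulr_ile1.
move=> w _; rewrite indicE; have := drawdown_time_ge0 a (path w) n.
case tE : (tau w) => [t| |]// _; last first.
  by rewrite discount_infty// !mul0r; under eq_fun do rewrite mul0r; exact: cvg_cst.
apply: cvgM; first exact: cvg_cst.
(* The ramps vanish at [x] itself, so they tend to the indicator of the strict inequality. *)
have [xX|Xx] := ltP x (path w t); last first.
  rewrite memNset; last by move=> -[_]; rewrite tE /= ltNge Xx.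
  by under eq_fun do rewrite ramp_terminal0//; exact: cvg_cst.
rewrite mem_set; last by rewrite /= tE ltry.
apply: cvg_near_cst; near=> i; apply/eqP.
rewrite /= ramp_terminal1// -lerBrDl ltW//.
by near: i; apply: (cvgr_lt _ ecvg); rewrite subr_gt0.
Unshelve. all: by end_near.
Qed.

End DrawdownMean.

Theorem theorem4p1 (d : measure_display) (T : measurableType d) (R : realType)
    (P : probability T R) (W : R -> {RV P >-> R})
    (HW : standard_brownian_motion W)
    (mu sigma a : R) (sigma_gt0 : 0 < sigma) (a_gt0 : 0 < a)
    (n : nat) (n_gt0 : (0 < n)%N)
    (lambda x : R) (lambda_gt0 : 0 < lambda) (x_gt0 : 0 < x) :
  let X := drifted_brownian_motion mu sigma W in
  let tau := fun w : T => drawdown_time a (fun t : R => X t w) n in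
  let b := b_const mu sigma a lambda in
  let c := c_const mu sigma a lambda in
  expectation_on P (fun w => discount lambda (tau w))
    [set w | (tau w < +oo)%E /\ x < X (fine (tau w)) w] =
  ((c / b) ^+ n * expR (- (b * (x + n%:R * a))) *
   \sum_(0 <= m < n) (b * (x + n%:R * a)) ^+ m / m`!%:R)%:E.
Proof.
rewrite /expectation_on unlock -[in RHS]mulrA -erlang_tailE /=.
apply: has_mean_integral; last exact: has_mean_drawdown.
by move=> w; rewrite mulr_ge0// discount_ge0.
Qed.
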